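(* The scalar curvature of the $\mathrm{SO}(4)$-invariant Bismut Hermitian–Einstein metric $g_c$ on the regular part $Q_3\setminus S^3$ along the curve $\gamma_r$ is given by $$\mathrm{Scal}_{g_c}=\frac{(5v_c^2+w_c^2)(w_c')^2}{v_c'\,\Delta_c^2}+\frac{40\,w_c^2}{v_c'\,\Delta_c\,\sinh^2(2r)},$$ where $w_c=c\left(r\coth(2r)-\frac12\right)$ and $\Delta_c=v_c^2-w_c^2$.
   Context: $Q_3=\{z\in\mathbb C^4:\sum_{j=1}^4 z_j^2=1\}$ with its standard complex structure $J$ and the linear action of $\mathrm{SO}(4)$; the singular orbit is $S^3=Q_3\cap\mathbb R^4$. With $e_1,\dots,e_4$ the standard basis, $\gamma_r=\gamma(r)=i\sinh(r)\,e_3+\cosh(r)\,e_4$, $r>0$. For $B\in\mathfrak{so}(4)$, $\hat B_p=\frac{d}{dt}|_{t=0}\exp(tB)p$. Let $E_{ij}$ be the skew matrix with $(i,j)$-entry $1$, $(j,i)$-entry $-1$ and other entries $0$; $A=E_{34}$, $X_i=E_{i3}$, $Y_i=E_{i4}$ $(i=1,2)$, $\xi=\gamma'(r)$. For $r>0$ let $\{dr,\eta,x_1,x_2,y_1,y_2\}$ be the coframe along $\gamma$ dual to $\{\xi,\hat A,\hat X_1,\hat X_2,\hat Y_1,\hat Y_2\}$; $\mathrm T(r)=\tanh(r)$; $\phi\odot\psi=\phi\otimes\psi+\psi\otimes\phi$. For $c\in\mathbb R$, $v_c$ is the solution (real-analytic and odd near $0$) of $$v''+2v'\frac{vv'+w_cw_c'}{v^2-w_c^2}-4v'\coth(2r)=0,\qquad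 v(0)=0,\quad v'(0)=1,$$ and $g_c$ is the $\mathrm{SO}(4)$-invariant Hermitian metric given along $\gamma$ by $$g_c=v_c'(dr^2+\eta^2)+v_c\Big[\mathrm T(x_1^2+x_2^2)+\tfrac1{\mathrm T}(y_1^2+y_2^2)\Big]+w_c(x_1\odot y_2-x_2\odot y_1),$$ considered for those $r>0$ for which the solution $v_c$ is defined and the metric is positive definite (all $r>0$ if $|c|\le1$). These metrics are Bismut Hermitian–Einstein, i.e. $dd^c\omega=0$ for $\omega=g_c(J\cdot,\cdot)$ and the Ricci form of the Bismut connection (the unique metric connection preserving $J$ with totally skew torsion) vanishes. $\mathrm{Scal}_{g_c}$ is the (Riemannian) scalar curvature of $g_c$. *)

(* Defs.v *)
From HB Require Import structures.
From mathcomp Require Import all_boot all_order all_algebra.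
From mathcomp Require Import all_classical all_reals all_analysis.
From mathcomp.real_closed Require Export complex.
Set Implicit Arguments.
Unset Strict Implicit.
Unset Printing Implicit Defensive.
Import Order.TTheory GRing.Theory Num.Theory.
Import numFieldNormedType.Exports.
Local Open Scope classical_set_scope.
Local Open Scope ring_scope.

Definition sinh (R : realType) (x : R) : R := (expR x - expR (- x)) / 2.
Definition cosh (R : realType) (x : R) : R := (expR x + expR (- x)) / 2.
Definition tanh (R : realType) (x : R) : R := sinh x / cosh x.
Definition coth (R : realType) (x : R) : R := cosh x / sinh x.

Section CoordinateCurvature.
Variables (R : realType) (n : nat).

Definition partial (V : normedModType R) (i : 'I_n) (f : 'rV[R]_n -> V) :
    'rV[R]_n -> V :=
  fun u => 'D_(delta_mx 0 i) f u.

(* C^oo on an open set: every iterated partial derivative is (Frechet)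
   differentiable there. *)
Definition smooth_on (V : normedModType R) (U : set 'rV[R]_n)
    (f : 'rV[R]_n -> V) : Prop :=
  forall (s : seq 'I_n) (u : 'rV[R]_n), U u ->
    differentiable (foldr (@partial V) f s) u.

Variable G : 'rV[R]_n -> 'M[R]_n.

Definition dG (i j k : 'I_n) : 'rV[R]_n -> R :=
  partial i (fun u => (G u j k : R^o)).

(* Gamma^k_{ij} *)
Definition christoffel (k i j : 'I_n) (u : 'rV[R]_n) : R :=
  2^-1 * \sum_l invmx (G u) k l * (dG i l j u + dG j l i u - dG l i j u).

(* R^l_{kij}, with R(d_i, d_j) d_k = sum_l R^l_{kij} d_l and
   R(X, Y) = [nabla_X, nabla_Y] - nabla_[X, Y] *)
Definition riemann (l k i j : 'I_n) (u : 'rV[R]_n) : R :=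
  partial i (christoffel l j k : _ -> R^o) u
  - partial j (christoffel l i k : _ -> R^o) u
  + \sum_m (christoffel l i m u * christoffel m j k u
            - christoffel l j m u * christoffel m i k u).

Definition ricci (j k : 'I_n) (u : 'rV[R]_n) : R :=
  \sum_i riemann i k i j u.

Definition scal (u : 'rV[R]_n) : R :=
  \sum_j \sum_k invmx (G u) j k * ricci j k u.

End CoordinateCurvature.

Section Quadric.
Variable R : realType.

(* A vector x + i y of C^4 is stored as the pair (x, y), so that C^4 carries
   its structure of real normed space. *)
Definition C4 : normedModType R := ('cV[R]_4 * 'cV[R]_4)%type.

Definition entry (z : C4) (j : 'I_4) : R[i] := (z.1 j 0 +i* z.2 j 0)%C.

Definition Q3 : set C4 := [set z | \sum_j entry z j ^+ 2 = 1].

Definition tangentQ3 (z : C4) : set C4 :=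
  [set u | \sum_j entry z j * entry u j = 0].

Definition J (u : C4) : C4 := (- u.2, u.1).

Definition SO4 : set 'M[R]_4 := [set P | P^T *m P = 1%:M /\ \det P = 1].

Definition act (P : 'M[R]_4) (z : C4) : C4 := (P *m z.1, P *m z.2).

(* The i-th standard basis vector and the matrices E_{ij}, numbered from 1. *)
Definition e (i : nat) : 'cV[R]_4 := \col_a (a.+1 == i)%:R.

Definition E (i j : nat) : 'M[R]_4 :=
  \matrix_(a, b) (((a.+1 == i) && (b.+1 == j))%:R
                  - ((a.+1 == j) && (b.+1 == i))%:R).

Definition expmx (B : 'M[R]_4) : 'M[R]_4 :=
  limn (series (fun k => (k`!%:R)^-1 *: (B ^+ k : 'M[R]_4))).

Definition hat (B : 'M[R]_4) (p : C4) : C4 :=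
  derive1 (fun t : R => act (expmx (t *: B)) p) 0.

Definition gamma (r : R) : C4 := (cosh r *: e 4, sinh r *: e 3).

(* xi, \hat A, \hat X_1, \hat X_2, \hat Y_1, \hat Y_2 *)
Definition frame (r : R) : 6.-tuple C4 :=
  [tuple derive1 gamma r;
         hat (E 3 4) (gamma r);
         hat (E 1 3) (gamma r);
         hat (E 2 3) (gamma r);
         hat (E 1 4) (gamma r);
         hat (E 2 4) (gamma r)].

(* The tangent vector at gamma r on which the dual coframe
   dr, eta, x_1, x_2, y_1, y_2 takes the values a 0 0, ..., a 0 5. *)
Definition framevec (r : R) (a : 'rV[R]_6) : C4 :=
  \sum_(k < 6) a 0 k *: tnth (frame r) k.

Definition coform (k : nat) (a : 'rV[R]_6) : R := a 0 (inord k).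
Notation dr := (coform 0).
Notation eta := (coform 1).
Notation x1 := (coform 2).
Notation x2 := (coform 3).
Notation y1 := (coform 4).
Notation y2 := (coform 5).

Definition tsquare (f : 'rV[R]_6 -> R) (a b : 'rV[R]_6) : R := f a * f b.
Definition odot (f h : 'rV[R]_6 -> R) (a b : 'rV[R]_6) : R :=
  f a * h b + h a * f b.

Definition w (c r : R) : R := c * (r * coth (2 * r) - 2^-1).

Definition g_along (c : R) (v : R -> R) (r : R) (a b : 'rV[R]_6) : R :=
  derive1 v r * (tsquare dr a b + tsquare eta a b)
  + v r * (tanh r * (tsquare x1 a b + tsquare x2 a b)
           + (tanh r)^-1 * (tsquare y1 a b + tsquare y2 a b))
  + w c r * (odot x1 y2 a b - odot x2 y1 a b).

(* v is a solution of the singular initial value problem, defined on an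
   interval reaching up to rho (possibly +oo). *)
Definition is_solution (c : R) (rho : \bar R) (v : R -> R) : Prop :=
  [/\ exists2 eps : R, 0 < eps &
        (forall x, `|x| < eps -> v (- x) = - v x) /\
        exists a : R ^nat, forall x, `|x| < eps ->
          series (fun k => a k * x ^+ k) @ \oo --> v x,
      v 0 = 0,
      derive1 v 0 = 1 &
      forall s : R, 0 < s -> (s%:E < rho)%E ->
        [/\ derivable v s 1, derivable (derive1 v) s 1,
            v s ^+ 2 - w c s ^+ 2 != 0 &
            derive1 (derive1 v) s
            + 2 * derive1 v s * ((v s * derive1 v s + w c s * derive1 (w c) s)
                              / (v s ^+ 2 - w c s ^+ 2))
            - 4 * derive1 v s * coth (2 * s) = 0]].

(* The part SO(4).gamma(]0, rho[) of Q_3 \ S^3; it is all of Q_3 \ S^3 when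
   rho = +oo. *)
Definition tube (rho : \bar R) : set C4 :=
  [set z | exists P s, [/\ SO4 P, 0 < s, (s%:E < rho)%E & z = act P (gamma s)]].

(* g z u u' is the value of the tensor g at z on the tangent vectors u, u'; its
   values on non-tangent vectors are irrelevant.  Positivity is a separate
   condition. *)
Definition invariant_hermitian (M : set C4) (g : C4 -> C4 -> C4 -> R) : Prop :=
  forall z u u', M z -> tangentQ3 z u -> tangentQ3 z u' ->
  [/\ g z u u' = g z u' u,
      forall (k : R) t, tangentQ3 z t -> g z (k *: u + t) u' = k * g z u u' + g z t u',
      g z (J u) (J u') = g z u u' &
      forall P, SO4 P -> g (act P z) (act P u) (act P u') = g z u u'].

Definition positive_definite_at (g : C4 -> C4 -> C4 -> R) (z : C4) : Prop :=
  forall u, tangentQ3 z u -> u != 0 -> 0 < g z u u.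

Definition is_gc (c : R) (rho : \bar R) (v : R -> R)
    (g : C4 -> C4 -> C4 -> R) : Prop :=
  invariant_hermitian (tube rho) g /\
  forall (r : R) (a b : 'rV[R]_6), 0 < r -> (r%:E < rho)%E ->
    g (gamma r) (framevec r a) (framevec r b) = g_along c v r a b.

(* phi : U -> M smooth with linearly independent partial derivatives; for M
   open in Q_3 (real dimension 6) these are the local parametrizations of M. *)
Definition parametrization (M : set C4) (U : set 'rV[R]_6)
    (phi : 'rV[R]_6 -> C4) : Prop :=
  [/\ open U,
      forall u, U u -> M (phi u),
      smooth_on U phi &
      forall u (a : 'rV[R]_6), U u ->
        \sum_i a 0 i *: partial i phi u = 0 -> a = 0].

Definition pullback (g : C4 -> C4 -> C4 -> R) (phi : 'rV[R]_6 -> C4)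
    (u : 'rV[R]_6) : 'M[R]_6 :=
  \matrix_(i, j) g (phi u) (partial i phi u) (partial j phi u).

(* The scalar curvature of g at p is s: this is its value in every system of
   local coordinates of M around p. *)
Definition scalar_curvature_is (M : set C4) (g : C4 -> C4 -> C4 -> R) (p : C4)
    (s : R) : Prop :=
  forall (U : set 'rV[R]_6) (phi : 'rV[R]_6 -> C4) (u : 'rV[R]_6),
    parametrization M U phi -> U u -> phi u = p -> scal (pullback g phi) u = s.

Definition Delta (c : R) (v : R -> R) (r : R) : R := v r ^+ 2 - w c r ^+ 2.

End Quadric.

(* Main.v *)
Require Import Defs.
From HB Require Import structures.
From mathcomp Require Import all_boot all_order all_algebra.
From mathcomp Require Import all_classical all_reals all_analysis.
From mathcomp Require Import ring lra.
Import Order.TTheory GRing.Theory Num.Theory.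
Import numFieldNormedType.Exports.
Local Open Scope classical_set_scope.
Local Open Scope ring_scope.

(** The scalar curvature is computed by the method of moving frames.  Let phi be
a parametrization of the tube near gamma r.  Since SO(4) acts on the tube with
the curve gamma as a section, phi factors locally as phi = P . gamma(s) with P
valued in SO(4) and s real valued; such a lift is produced smoothly by
Gram-Schmidt (local_lift).  The Maurer-Cartan form P^T dP splits into an
isotropy part alpha, along E_12, and five other entries; together with ds these
form a coframe F in which the invariant metric is G = F^T h(s) F, where h(t) is
the Gram matrix of g_c in the frame xi, A, X_1, X_2, Y_1, Y_2 at gamma t
(partial_lift, pullback_lift, coframe_unit).

Both dF and d alpha are given by the structure constants of so(4), because of
the Maurer-Cartan equation (coframe_structure, isotropy_structure).  Hence the
Levi-Civita connection form is sum_c F^c L_c(s) + alpha rho, where rho is the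
adjoint action of E_12 and the matrices L_c(t) solve the algebraic equations of
vanishing torsion and metric compatibility with h(t).  The isotropy part drops
out of the curvature since every L_c is equivariant, so that the scalar
curvature is an explicit expression in L, L' and the structure constants
(christoffel_unique, riemann_coframe, scal_coframe, scal_cohomogeneity_one,
scal_lift).

The matrix h has four independent entries: V = v', p = v tanh, q = v / tanh and
w.  Solving for L and contracting gives a closed formula for the scalar
curvature of any invariant metric of this shape in terms of V, p, q, w and
their first two derivatives (scal_tab).  Substituting the differential equation
for v, which expresses V' and therefore V'', and the equation
w'' = 8 w / sinh^2 (2 r) satisfied by w_c, the formula collapses to the stated
one (scal_profile). *)

Set Implicit Arguments.
Unset Strict Implicit.
Unset Printing Implicit Defensive.

(** * Partial derivatives *)

Lemma differentiable_near (K : numFieldType) (V W : normedModType K)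
    (f g : V -> W) (u : V) : (\near u, f u = g u) ->
  differentiable f u -> differentiable g u.
Proof.
move=> fg /diff_locallyP[cf /eqaddoP ef].
have fgu := nbhs_singleton fg.
have eg : g \o shift u = cst (g u) + 'd f u +o_ 0 id.
  apply/eqaddoP => e e0; have {}ef := ef _ e0.
  have fg0 : \forall x \near 0, f (x + u) = g (x + u).
    by move: fg; rewrite (near_shift 0) subr0.
  apply: filterS2 fg0 ef => x xu.
  by rewrite !fctE /= /shift /= xu fgu.
apply/diff_locallyP; by rewrite (diff_unique cf eg); split.
Qed.

Section Calculus.
Variables (R : realType) (m : nat).
Implicit Types (f g : 'rV[R]_m -> R) (u : 'rV[R]_m) (i j : 'I_m).

(** The partial derivative with values in the field itself; the cast to R^o is
the normed module structure required by the general notion. *)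
Definition pd i f : 'rV[R]_m -> R := partial i (f : _ -> R^o).

Lemma pd_near i f g u : (\near u, f u = g u) -> pd i f u = pd i g u.
Proof. exact: (@near_eq_derive R _ R^o). Qed.

Lemma pd_cst i (k : R) u : pd i (fun=> k) u = 0.
Proof. exact: (@derive_cst R _ R^o). Qed.

Lemma pdD i f g u : differentiable f u -> differentiable g u ->
  pd i (fun x => f x + g x) u = pd i f u + pd i g u.
Proof. by move=> df dg; apply: (@deriveD R _ R^o); apply: diff_derivable. Qed.

Lemma pdB i f g u : differentiable f u -> differentiable g u ->
  pd i (fun x => f x - g x) u = pd i f u - pd i g u.
Proof. by move=> df dg; apply: (@deriveB R _ R^o); apply: diff_derivable. Qed.

Lemma pdN i f u : differentiable f u -> pd i (fun x => - f x) u = - pd i f u.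
Proof. by move=> df; apply: (@deriveN R _ R^o); apply: diff_derivable. Qed.

Lemma pdM i f g u : differentiable f u -> differentiable g u ->
  pd i (fun x => f x * g x) u = pd i f u * g u + f u * pd i g u.
Proof.
move=> df dg; rewrite addrC (mulrC _ (g u)).
by apply: (@deriveM R 'rV[R]_m); apply: diff_derivable.
Qed.

Lemma pd_sum i n (f : 'I_n -> 'rV[R]_m -> R) u :
  (forall k, differentiable (f k) u) ->
  pd i (fun x => \sum_k f k x) u = \sum_k pd i (f k) u.
Proof.
move=> df; have -> : (fun x => \sum_k f k x) = \sum_k f k.
  by apply/funext => x; rewrite fct_sumE.
by apply: (@derive_sum R _ R^o) => k; apply: diff_derivable.
Qed.

Lemma differentiable_comp1 f (g : R -> R) u :
  differentiable f u -> derivable g (f u) 1 ->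
  differentiable (fun x => g (f x)) u.
Proof.
move=> df dg; apply: (differentiable_comp df).
exact/derivable1_diffP.
Qed.

Lemma pd_comp i f (g : R -> R) u :
  differentiable f u -> derivable g (f u) 1 ->
  pd i (fun x => g (f x)) u = derive1 g (f u) * pd i f u.
Proof.
move=> df dg.
have dg' : differentiable g (f u) by exact/derivable1_diffP.
rewrite /pd /partial.
transitivity ('d (g \o f) u (delta_mx 0 i)).
  by apply: deriveE; apply: differentiable_comp.
rewrite diff_comp//= deriv1E//=.
by rewrite mulrC (@deriveE _ _ _ f).
Qed.

Lemma pd_shift i f c u : pd i (fun x => f (x + c)) u = pd i f (u + c).
Proof.
rewrite /pd /partial /derive.
have -> // : (fun h : R => h^-1 *: (((fun x => f (x + c) : R^o) \o shift u)
    (h *: delta_mx 0 i) - f (u + c))) =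
  (fun h : R => h^-1 *: ((f \o shift (u + c)) (h *: delta_mx 0 i) - f (u + c))).
by apply/funext => h /=; rewrite addrA.
Qed.

Lemma differentiable_shift f c u :
  differentiable f (u + c) -> differentiable (fun x => f (x + c)) u.
Proof.
move=> df; have d1 : differentiable (fun x : 'rV[R]_m => x + c) u.
  have -> : (fun x : 'rV[R]_m => x + c) = id + cst c by [].
  by apply: differentiableD => //; exact: differentiable_cst.
exact: (differentiable_comp d1).
Qed.

(** Restricted to a coordinate line, a function of several variables is a
function of one variable, to which the mean value theorem applies. *)
Lemma is_derive_line i f u (x : R) : differentiable f (u + x *: delta_mx 0 i) ->
  is_derive x 1 (fun y => f (u + y *: delta_mx 0 i))
    (pd i f (u + x *: delta_mx 0 i)).
Proof.
move=> /diff_derivable - /(_ (delta_mx 0 i)) df.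
have E : (fun h : R => h^-1 *: (((fun y => f (u + y *: delta_mx 0 i)) \o shift x)
    (h *: (1 : R)) - f (u + x *: delta_mx 0 i))) =
  (fun h : R => h^-1 *: ((f \o shift (u + x *: delta_mx 0 i)) (h *: delta_mx 0 i)
     - f (u + x *: delta_mx 0 i))).
  apply/funext => h /=; rewrite /shift /= -[h *: 1]/(h * 1) mulr1 scalerDl.
  by rewrite addrCA.
by split; rewrite /derivable /derive E.
Qed.

Opaque pd.

Lemma mvt_line i f u (t : R) : 0 <= t ->
  (forall x, 0 <= x <= t -> differentiable f (u + x *: delta_mx 0 i)) ->
  exists2 x, 0 <= x <= t &
    f (u + t *: delta_mx 0 i) - f u = pd i f (u + x *: delta_mx 0 i) * t.
Proof.
move=> t0 df.
have dfa x : 0 <= x <= t -> is_derive x 1 (fun y => f (u + y *: delta_mx 0 i))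
   (pd i f (u + x *: delta_mx 0 i)).
  by move=> /df; apply: is_derive_line.
have [||x] := @MVT_segment R (fun y => f (u + y *: delta_mx 0 i))
   (fun x => pd i f (u + x *: delta_mx 0 i)) 0 t t0.
- by move=> x; rewrite in_itv/= => /andP[? ?]; apply: dfa; apply/andP; split; apply: ltW.
- apply: derivable_within_continuous => x; rewrite in_itv/= => xt.
  by have [] := dfa _ xt.
rewrite in_itv/= subr0 => xt E; exists x => //.
by move: E; rewrite /= scale0r addr0.
Qed.

(** All iterated partial derivatives of order less than n are differentiable on
W.  This lies between C^(n-1) and C^n, and is stable under the operations used
below by plain induction on n. *)
Fixpoint Ck (W : set 'rV[R]_m) n f : Prop :=
  if n is k.+1 then (forall u, W u -> differentiable f u) /\
                    forall i, Ck W k (pd i f)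
  else True.

(** Two applications of the mean value theorem, first along i to the difference
of f in the direction j, then along j.  The left-hand side is symmetric in i
and j. *)
Lemma second_difference i j f u (t e : R) : 0 < e ->
  (forall x, `|x| < e -> differentiable f (u + x)) ->
  (forall x, `|x| < e -> differentiable (pd i f) (u + x)) ->
  0 <= t -> t * (`|delta_mx 0 i : 'rV[R]_m| + `|delta_mx 0 j : 'rV[R]_m|) < e ->
  exists2 x, `|x| < e &
    f (u + t *: delta_mx 0 i + t *: delta_mx 0 j) - f (u + t *: delta_mx 0 i)
    - f (u + t *: delta_mx 0 j) + f u = pd j (pd i f) (u + x) * t * t.
Proof.
move=> e0 df dpf t0 te.
set ei := delta_mx 0 i : 'rV[R]_m; set ej := delta_mx 0 j : 'rV[R]_m.
have small x y : 0 <= x <= t -> 0 <= y <= t -> `|x *: ei + y *: ej| < e.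
  move=> /andP[x0 xt] /andP[y0 yt]; apply: le_lt_trans te.
  apply: le_trans (ler_normD _ _) _.
  rewrite !normrZ (ger0_norm x0) (ger0_norm y0) mulrDr.
  by apply: lerD; apply: ler_wpM2r.
have t00 : 0 <= t <= t by rewrite t0 lexx.
have z00 : 0 <= (0 : R) <= t by rewrite lexx.
have d1 x : 0 <= x <= t -> differentiable f (u + x *: ei).
  by move=> xt; apply: df; have := small _ _ xt z00; rewrite scale0r addr0.
have d2 x : 0 <= x <= t ->
    differentiable (fun y => f (y + t *: ej)) (u + x *: ei).
  move=> xt; apply: differentiable_shift.
  by rewrite -addrA; apply: df; apply: small.
have [x xt] := @mvt_line i (fun y => f (y + t *: ej) - f y) u t t0
  (fun x xt => differentiableB (d2 x xt) (d1 x xt)).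
rewrite pdB; [|exact: d2|exact: d1].
rewrite pd_shift => E.
have [|y yt E2] := @mvt_line j (pd i f) (u + x *: ei) t t0.
  by move=> y yt; rewrite -addrA; apply: dpf; apply: small.
exists (x *: ei + y *: ej); first exact: small.
by rewrite addrA -E2 -E opprB addrA (addrAC _ (- f _)) (addrAC _ (f u)).
Qed.

Lemma Ck_le W n k f : (k <= n)%N -> Ck W n f -> Ck W k f.
Proof.
elim: n k f => [|n IH] [|k] f //= kn [d p].
by split; [exact: d|move=> i; apply: IH].
Qed.

Lemma Ck_differentiable W n f u : Ck W n.+1 f -> W u -> differentiable f u.
Proof. by move=> [d _]; apply: d. Qed.

Lemma Ck_pd W n i f : Ck W n.+1 f -> Ck W n (pd i f).
Proof. by move=> [_ h]; apply: h. Qed.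

(** Symmetry of second derivatives (Young).  The symmetric second difference
equals t^2 times either mixed derivative at some nearby point; as both mixed
derivatives are continuous, they cannot differ at u. *)
Lemma pdC W i j f u : open W -> W u -> Ck W 3 f ->
  pd i (pd j f) u = pd j (pd i f) u.
Proof.
move=> oW Wu f3; set a := LHS; set b := RHS.
apply/eqP/negPn/negP => ab.
pose d := `|a - b| / 2.
have d0 : 0 < d by rewrite divr_gt0// normr_gt0 subr_eq0.
(* If the mixed derivatives differ by 2 d at u, they remain apart on the ball
   where each of them varies by less than d. *)
have near_pd k l : \forall x \near u, `|pd k (pd l f) u - pd k (pd l f) x| < d.
  have /differentiable_continuous c : differentiable (pd k (pd l f)) u.
    by apply: (@Ck_differentiable W 0) => //; do 2 apply: Ck_pd.
  by move/cvgr_dist_lt : c; apply.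
have : \forall x \near u, [/\ W x, `|a - pd i (pd j f) x| < d &
                              `|b - pd j (pd i f) x| < d].
  have nW : nbhs u W by exact: open_nbhs_nbhs.
  by apply: filterS3 nW (near_pd i j) (near_pd j i) => x Wx ha hb; exact: And3 Wx ha hb.
move=> /nbhs_ballP[e /= e0 be].
have ue x : `|x| < e -> ball u e (u + x).
  by move=> xe; rewrite -ball_normE /= opprD addNKr normrN.
set nm := `|delta_mx 0 i : 'rV[R]_m| + `|delta_mx 0 j : 'rV[R]_m|.
have nm0 : 0 <= nm by rewrite addr_ge0.
pose t := e / (nm + 1) / 2.
have nm1 : 0 < nm + 1 by rewrite ltr_wpDl.
have t0 : 0 < t by rewrite !divr_gt0.
have te : t * nm < e.
  have x0 : 0 < e / (nm + 1) by rewrite divr_gt0.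
  have xE : e = e / (nm + 1) * (nm + 1) by rewrite divfK// lt0r_neq0.
  by rewrite /t [ltRHS]xE; move: (e / _) x0 => x x0; nra.
have df x : `|x| < e -> differentiable f (u + x).
  by move=> /ue/be[Wx _ _]; apply: (@Ck_differentiable W 2).
have dpf k x : `|x| < e -> differentiable (pd k f) (u + x).
  by move=> /ue/be[Wx _ _]; apply: (@Ck_differentiable W 1) => //; apply: Ck_pd.
have [x xe] := second_difference e0 df (dpf i) (ltW t0) te.
have te' : t * (`|delta_mx 0 j : 'rV[R]_m| + `|delta_mx 0 i : 'rV[R]_m|) < e.
  by rewrite (addrC `|_|).
have [y ye] := second_difference e0 df (dpf j) (ltW t0) te'.
move=> E E'.
have swap : f (u + t *: delta_mx 0 j + t *: delta_mx 0 i)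
    - f (u + t *: delta_mx 0 j) - f (u + t *: delta_mx 0 i) + f u =
  f (u + t *: delta_mx 0 i + t *: delta_mx 0 j)
    - f (u + t *: delta_mx 0 i) - f (u + t *: delta_mx 0 j) + f u.
  rewrite (addrAC u); congr (_ + _); exact: addrAC.
have {swap E E'} E3 := etrans (esym E) (etrans swap E').
have {}E3 := mulIf (lt0r_neq0 t0) (mulIf (lt0r_neq0 t0) E3).
have [_ hb _] := be _ (ue _ ye); have [_ _ ha] := be _ (ue _ xe).
move: hb; rewrite E3 => hb.
move: (pd j (pd i f) (u + x)) ha hb => p ha hb.
suff : `|a - b| < d + d by rewrite -splitr ltxx.
rewrite -(subrKA p); apply: le_lt_trans (ler_normD _ _) _; apply: ltrD hb _.
by rewrite distrC.
Qed.

Lemma Ck_subset (W W' : set 'rV[R]_m) n f : W' `<=` W -> Ck W n f -> Ck W' n f.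
Proof.
move=> s; elim: n f => [//|n IH] f [d p].
by split=> [u /s|i]; [exact: d|apply: IH (p i)].
Qed.

Lemma Ck_eq W n f g : open W -> (forall u, W u -> f u = g u) ->
  Ck W n f -> Ck W n g.
Proof.
move=> oW; elim: n f g => [//|n IH] f g fg [d p].
have nfg u : W u -> \near u, f u = g u.
  by move=> Wu; near=> x; apply: fg; near: x; exact: open_nbhs_nbhs.
split=> [u Wu|i]; first by apply: differentiable_near (nfg _ Wu) (d _ Wu).
by apply: IH (p i) => u Wu; apply: pd_near; apply: nfg.
Unshelve. all: by end_near.
Qed.

Lemma Ck_cst W n (k : R) : Ck W n (fun=> k).
Proof.
elim: n k => [//|n IH] k; split=> [u _|i]; first exact: differentiable_cst.
have -> : pd i (fun=> k) = fun=> 0 by apply/funext => u; rewrite pd_cst.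
exact: IH.
Qed.

Section OpenSet.
Variable W : set 'rV[R]_m.
Hypothesis oW : open W.

Lemma CkD n f g : Ck W n f -> Ck W n g -> Ck W n (fun x => f x + g x).
Proof.
elim: n f g => [//|n IH] f g [df pf] [dg pg].
split=> [u Wu|i]; first by apply: differentiableD; [exact: df|exact: dg].
apply: Ck_eq (IH _ _ (pf i) (pg i)) => // u Wu.
by rewrite pdD//; [exact: df|exact: dg].
Qed.

Lemma CkN n f : Ck W n f -> Ck W n (fun x => - f x).
Proof.
elim: n f => [//|n IH] f [df pf].
split=> [u Wu|i]; first by apply: differentiableN; exact: df.
apply: Ck_eq (IH _ (pf i)) => // u Wu.
by rewrite pdN//; exact: df.
Qed.

Lemma CkB n f g : Ck W n f -> Ck W n g -> Ck W n (fun x => f x - g x).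
Proof. by move=> Cf Cg; apply: CkD => //; apply: CkN. Qed.

Lemma CkM n f g : Ck W n f -> Ck W n g -> Ck W n (fun x => f x * g x).
Proof.
elim: n f g => [//|n IH] f g Cf Cg; have [df pf] := Cf; have [dg pg] := Cg.
split=> [u Wu|i]; first by apply: differentiableM; [exact: df|exact: dg].
apply: Ck_eq (CkD (IH _ _ (pf i) (Ck_le (leqnSn n) Cg))
                  (IH _ _ (Ck_le (leqnSn n) Cf) (pg i))) => // u Wu.
by rewrite pdM//; [exact: df|exact: dg].
Qed.

Lemma Ck_sum n k (f : 'I_k -> 'rV[R]_m -> R) : (forall a, Ck W n (f a)) ->
  Ck W n (fun x => \sum_a f a x).
Proof.
elim: k f => [|k IH] f Cf.
  by have -> : (fun x => \sum_a f a x) = (fun=> 0);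
    [apply/funext => x; rewrite big_ord0|exact: Ck_cst].
have -> : (fun x => \sum_a f a x) =
    (fun x => f ord0 x + \sum_a f (lift ord0 a) x).
  by apply/funext => x; rewrite big_ord_recl.
by apply: CkD => //; apply: IH => a.
Qed.

(** The chain rule lowers the order by one, so regularity of g o f at order n+1
follows from that of g' o f at order n; for exp and the inverse, g' is a polynomial in
g, which closes an induction. *)
Lemma Ck_comp n f (g g' : R -> R) :
  (forall u, W u -> derivable g (f u) 1 /\ derive1 g (f u) = g' (f u)) ->
  Ck W n.+1 f -> Ck W n (fun x => g' (f x)) -> Ck W n.+1 (fun x => g (f x)).
Proof.
move=> dg [df pf] Cg'; split=> [u Wu|i].
  by apply: differentiable_comp1; [exact: df|have [] := dg _ Wu].
apply: Ck_eq (CkM Cg' (pf i)) => // u Wu.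
by have [d1 d2] := dg _ Wu; rewrite pd_comp//; [rewrite d2|exact: df].
Qed.

Lemma Ck_exp n f : Ck W n f -> Ck W n (fun x => expR (f x)).
Proof.
elim: n => [//|n IH] Cf; apply: (Ck_comp _ Cf); last first.
  exact: IH (Ck_le (leqnSn n) Cf).
by move=> u _; split=> //; rewrite derive1E; exact: derive_val.
Qed.

Lemma Ck_inv n f : (forall u, W u -> f u != 0) -> Ck W n f ->
  Ck W n (fun x => (f x)^-1).
Proof.
move=> f0; elim: n => [//|n IH] Cf; have C := IH (Ck_le (leqnSn n) Cf).
apply: (@Ck_comp _ _ (fun x => x^-1) (fun x => - (x^-1 * x^-1)) _ Cf); last first.
  by apply: CkN; apply: CkM.
move=> u Wu; have fu := f0 _ Wu.
have di := @derivable_id R _ (f u) 1.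
split; first exact: (derivableV fu di).
rewrite derive1E (deriveV fu di) derive_id -invfM.
by rewrite [LHS]mulr1 expr2.
Qed.

Lemma Ck_ln n f : (forall u, W u -> 0 < f u) -> Ck W n f ->
  Ck W n (fun x => ln (f x)).
Proof.
move=> f0; case: n => [//|n] Cf.
apply: (@Ck_comp _ _ _ (fun x => x^-1) _ Cf); last first.
  apply: Ck_inv; last exact: Ck_le (leqnSn n) Cf.
  by move=> u /f0/lt0r_neq0.
move=> u Wu; have H := is_derive1_ln (f0 _ Wu).
by split=> //; rewrite derive1E; exact: derive_val.
Qed.

End OpenSet.
End Calculus.
Opaque pd.

(** * Partial derivatives of matrix-valued functions *)

Section MatrixCalculus.
Variables (R : realType) (n : nat).
Local Notation V := 'rV[R]_n.

Lemma differentiable_bigsum I (r : seq I) (f : I -> V -> R) u :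
  (forall k, differentiable (f k) u) ->
  differentiable (fun x => \sum_(k <- r) f k x) u.
Proof.
move=> df; elim: r => [|k r IH].
  have -> : (fun x => \sum_(k <- [::]) f k x) = cst 0.
    by apply/funext => x; rewrite big_nil.
  exact: differentiable_cst.
have -> : (fun x => \sum_(k <- k :: r) f k x) =
    (fun x => f k x + \sum_(k <- r) f k x).
  by apply/funext => x; rewrite big_cons.
exact: differentiableD.
Qed.

Lemma differentiable_bigprod I (r : seq I) (f : I -> V -> R) u :
  (forall k, differentiable (f k) u) ->
  differentiable (fun x => \prod_(k <- r) f k x) u.
Proof.
move=> df; elim: r => [|k r IH].
  have -> : (fun x => \prod_(k <- [::]) f k x) = cst 1.
    by apply/funext => x; rewrite big_nil.
  exact: differentiable_cst.
have -> : (fun x => \prod_(k <- k :: r) f k x) =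
    (fun x => f k x * \prod_(k <- r) f k x).
  by apply/funext => x; rewrite big_cons.
exact: differentiableM.
Qed.

Definition mx_differentiable p q (A : V -> 'M[R]_(p, q)) (u : V) :=
  forall a b, differentiable (fun x => A x a b) u.

Definition dmx p q i (A : V -> 'M[R]_(p, q)) (u : V) : 'M[R]_(p, q) :=
  \matrix_(a, b) pd i (fun x => A x a b) u.

Lemma dmx_near p q i (A B : V -> 'M[R]_(p, q)) u :
  (\near u, A u = B u) -> dmx i A u = dmx i B u.
Proof.
move=> AB; apply/matrixP => a b; rewrite !mxE; apply: pd_near.
by apply: filterS AB => x ->.
Qed.

Lemma mx_differentiableD p q (A B : V -> 'M[R]_(p, q)) u :
  mx_differentiable A u -> mx_differentiable B u ->
  mx_differentiable (fun x => A x + B x) u.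
Proof.
move=> dA dB a b; have -> : (fun x => (A x + B x) a b) =
  (fun x => A x a b + B x a b) by apply/funext => x; rewrite mxE.
exact: differentiableD.
Qed.

Lemma dmxD p q i (A B : V -> 'M[R]_(p, q)) u :
  mx_differentiable A u -> mx_differentiable B u ->
  dmx i (fun x => A x + B x) u = dmx i A u + dmx i B u.
Proof.
move=> dA dB; apply/matrixP => a b; rewrite !mxE -pdD//.
by congr (pd _ _ _); apply/funext => x; rewrite mxE.
Qed.

Lemma mx_differentiableM p q r (A : V -> 'M[R]_(p, q)) (B : V -> 'M[R]_(q, r)) u :
  mx_differentiable A u -> mx_differentiable B u ->
  mx_differentiable (fun x => A x *m B x) u.
Proof.
move=> dA dB a b; have -> : (fun x => (A x *m B x) a b) =
  (fun x => \sum_c A x a c * B x c b) by apply/funext => x; rewrite mxE.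
by apply: differentiable_bigsum => c; exact: differentiableM.
Qed.

Lemma dmxM p q r i (A : V -> 'M[R]_(p, q)) (B : V -> 'M[R]_(q, r)) u :
  mx_differentiable A u -> mx_differentiable B u ->
  dmx i (fun x => A x *m B x) u = dmx i A u *m B u + A u *m dmx i B u.
Proof.
move=> dA dB; apply/matrixP => a b; rewrite !mxE.
have -> : (fun x => (A x *m B x) a b) =
  (fun x => \sum_c A x a c * B x c b) by apply/funext => x; rewrite mxE.
rewrite pd_sum -?big_split/=; last by move=> c; exact: differentiableM.
by apply: eq_bigr => c _; rewrite pdM// !mxE.
Qed.

Lemma mx_differentiable_tr p q (A : V -> 'M[R]_(p, q)) u :
  mx_differentiable A u -> mx_differentiable (fun x => (A x)^T) u.
Proof.
move=> dA a b; have -> : (fun x => (A x)^T a b) = (fun x => A x b a).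
  by apply/funext => x; rewrite mxE.
exact: dA.
Qed.

Lemma dmx_tr p q i (A : V -> 'M[R]_(p, q)) u :
  dmx i (fun x => (A x)^T) u = (dmx i A u)^T.
Proof.
apply/matrixP => a b; rewrite !mxE; congr (pd _ _ _).
by apply/funext => x; rewrite mxE.
Qed.

Lemma differentiable_det p (A : V -> 'M[R]_p) u :
  mx_differentiable A u -> differentiable (fun x => \det (A x)) u.
Proof.
move=> dA; rewrite /determinant; apply: differentiable_bigsum => s.
apply: differentiableM; first exact: differentiable_cst.
by apply: differentiable_bigprod => a.
Qed.

Lemma mx_differentiable_inv p (A : V -> 'M[R]_p) u :
  (\near u, A u \in unitmx) -> mx_differentiable A u ->
  mx_differentiable (fun x => invmx (A x)) u.
Proof.
move=> uA dA a b; have Au := nbhs_singleton uA.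
apply: (@differentiable_near R V R (fun x => (\det (A x))^-1 * cofactor (A x) b a)).
  by apply: filterS uA => x Ax; rewrite /invmx Ax !mxE.
apply: differentiableM.
  apply: differentiableV; first exact: differentiable_det.
  by move: Au; rewrite unitmxE unitfE.
apply: differentiableM; first exact: differentiable_cst.
apply: differentiable_det => c d.
have -> : (fun x => row' b (col' a (A x)) c d) =
  (fun x => A x (lift b c) (lift a d)) by apply/funext => x; rewrite !mxE.
exact: dA.
Qed.

End MatrixCalculus.

(** * Christoffel symbols and curvature in a moving coframe *)

(** Proves identities between sums of matrices by comparing entries, once
products and derivatives of matrices have been made opaque. *)
Ltac mx_abel :=
  repeat match goal with |- context [@mulmx ?K ?p ?q ?r ?A ?B] =>
    move: (@mulmx K p q r A B) => ? end;
  repeat match goal with |- context [@dmx ?K ?m ?p ?q ?i ?A ?u] =>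
    move: (@dmx K m p q i A u) => ? end;
  apply/matrixP => ? ?; rewrite !mxE; ring.
Section Cartan.
Variables (R : realType) (n : nat).
Local Notation V := 'rV[R]_n.
Implicit Types (u : V).

(** Uniqueness of the Levi-Civita connection: a torsion-free family Ga of
matrices with nabla G = 0 is recovered from the derivatives of G by the Koszul
formula. *)
Lemma christoffel_unique (G : V -> 'M[R]_n) (Ga : 'I_n -> 'M[R]_n) u k i j :
  G u \in unitmx -> (G u)^T = G u ->
  (forall a, dmx a G u = (G u *m Ga a)^T + G u *m Ga a) ->
  (forall a b c, Ga a c b = Ga b c a) ->
  christoffel G k i j u = Ga i k j.
Proof.
move=> uG sG dGE torsion.
have BC a b c : (G u *m Ga a) c b = (G u *m Ga b) c a.
  by rewrite !mxE; apply: eq_bigr => d _; rewrite torsion.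
have dE a b c : dG G a b c u = (G u *m Ga a) c b + (G u *m Ga a) b c.
  have := congr1 (fun A : 'M[R]_n => A b c) (dGE a).
  by rewrite [in LHS]mxE [in RHS]mxE [trmx _ _ _]mxE.
have key l : dG G i l j u + dG G j l i u - dG G l i j u = 2 * (G u *m Ga i) l j.
  rewrite !dE (BC i l j) (BC j l i) (BC j i l).
  by move: ((G u *m Ga l) j i) ((G u *m Ga l) i j) ((G u *m _) l j) => x y z; ring.
rewrite /christoffel; under eq_bigr => l _ do rewrite key mulrCA.
rewrite -big_distrr/= mulrA mulVf ?mul1r; last by rewrite pnatr_eq0.
by rewrite -[in RHS](mul1mx (Ga i)) -(mulVmx uG) -mulmxA [in RHS]mxE.
Qed.

(* G is the coordinate Gram matrix of a metric with Gram matrix h in the coframe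
   whose components are the rows of F, and om is its connection form in that
   coframe: om is torsion-free and compatible with h. *)
Variables (G F h : V -> 'M[R]_n) (om : 'I_n -> V -> 'M[R]_n) (W : set V).
Hypothesis oW : open W.
Hypothesis GE : forall u, W u -> G u = (F u)^T *m h u *m F u.
Hypothesis uF : forall u, W u -> F u \in unitmx.
Hypothesis uh : forall u, W u -> h u \in unitmx.
Hypothesis sh : forall u, W u -> (h u)^T = h u.
Hypothesis CF : forall a b, Ck W 3 (fun u => F u a b).
Hypothesis dh : forall u, W u -> mx_differentiable h u.
Hypothesis dom : forall i u, W u -> mx_differentiable (om i) u.
Hypothesis torsion : forall u i j a, W u ->
  (dmx i F u + om i u *m F u) a j = (dmx j F u + om j u *m F u) a i.
Hypothesis compat : forall u i, W u ->
  dmx i h u = (h u *m om i u)^T + h u *m om i u.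

(** The connection form om read in coordinates: F^-1 dF + F^-1 om F. *)
Definition gauge_transform i u := invmx (F u) *m (dmx i F u + om i u *m F u).

Local Notation Ga := gauge_transform.

Let F_differentiable u : W u -> mx_differentiable F u.
Proof. by move=> Wu a b; apply: (Ck_differentiable (CF a b)). Qed.

Let dF_differentiable i u : W u -> mx_differentiable (dmx i F) u.
Proof.
move=> Wu a b; have := Ck_differentiable (Ck_pd i (CF a b)) Wu.
by congr (differentiable _ _); apply/funext => x; rewrite mxE.
Qed.

Let F_Ga i u : W u -> F u *m Ga i u = dmx i F u + om i u *m F u.
Proof. by move=> Wu; rewrite mulmxA mulmxV ?mul1mx ?uF. Qed.

Let uG u : W u -> G u \in unitmx.
Proof. by move=> Wu; rewrite GE// !unitmx_mul unitmx_tr uF ?uh. Qed.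

(** The change of gauge turns compatibility with h into compatibility with
G = F^T h F, and the first structure equation into symmetry of the lower
indices; uniqueness does the rest. *)
Lemma christoffel_coframe k i j u : W u -> christoffel G k i j u = Ga i u k j.
Proof.
move=> Wu; apply: (christoffel_unique (Ga := fun a => Ga a u)); rewrite ?uG//.
- by rewrite GE// !trmx_mul trmxK sh// mulmxA.
- move=> a; rewrite (@dmx_near _ _ _ _ _ _ (fun x => (F x)^T *m h x *m F x)).
    have dFt := mx_differentiable_tr (F_differentiable Wu).
    have dFh := mx_differentiableM dFt (dh Wu).
    rewrite (dmxM _ dFh (F_differentiable Wu)) (dmxM _ dFt (dh Wu)) dmx_tr.
    rewrite compat// GE// -!mulmxA F_Ga//.
    rewrite !trmx_mul !trmxK !(linearD, mulmxDl, mulmxDr)/= !trmx_mul sh//.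
    rewrite !mulmxA -!addrA; congr (_ + _).
    by congr (_ + _); exact: addrC.
  by near=> x; apply: GE; near: x; exact: open_nbhs_nbhs.
- move=> a b c; rewrite !mxE; apply: eq_bigr => d _.
  by rewrite torsion.
Unshelve. all: by end_near.
Qed.

Definition curvature_form i j u :=
  dmx i (om j) u - dmx j (om i) u + (om i u *m om j u - om j u *m om i u).

Let Ga_differentiable i u : W u -> mx_differentiable (Ga i) u.
Proof.
move=> Wu; apply: mx_differentiableM.
  apply: mx_differentiable_inv; last exact: F_differentiable.
  by near=> x; apply: uF; near: x; exact: open_nbhs_nbhs.
apply: mx_differentiableD; first exact: dF_differentiable.
by apply: mx_differentiableM; [exact: dom|exact: F_differentiable].
Unshelve. all: by end_near.
Qed.

Lemma ddF_sym i j u : W u -> dmx i (dmx j F) u = dmx j (dmx i F) u.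
Proof.
move=> Wu; apply/matrixP => a b; rewrite [LHS]mxE [RHS]mxE.
have E k : (fun x => dmx k F x a b) = pd k (fun x => F x a b).
  by apply/funext => x; rewrite mxE.
by rewrite !E; apply: (pdC _ _ oW Wu).
Qed.

Let F_dGa i j u : W u -> F u *m dmx i (Ga j) u =
  dmx i (dmx j F) u + dmx i (om j) u *m F u - om j u *m om i u *m F u
  + om i u *m F u *m Ga j u + om j u *m F u *m Ga i u
  - F u *m Ga i u *m Ga j u.
Proof.
move=> Wu; have dFu := F_differentiable Wu.
have := dmxM i dFu (Ga_differentiable j Wu).
rewrite (@dmx_near _ _ _ _ _ _ (fun x => dmx j F x + om j x *m F x)); last first.
  by near=> x; apply: F_Ga; near: x; exact: open_nbhs_nbhs.
rewrite (dmxD _ (dF_differentiable j Wu) (mx_differentiableM (dom j Wu) dFu)).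
rewrite (dmxM _ (dom j Wu) dFu).
have dFE k : dmx k F u = F u *m Ga k u - om k u *m F u.
  by rewrite F_Ga// addrK.
move=> H; apply: (addrI (dmx i F u *m Ga j u)); rewrite -H {H}.
rewrite !dFE; move: (Ga i u) (Ga j u) => A B.
rewrite !(mulmxBl, mulmxBr) !mulmxA.
by mx_abel.
Unshelve. all: by end_near.
Qed.

(** The curvature form is a tensor: under the change of gauge it is only
conjugated by F.  The inhomogeneous terms cancel by symmetry of the second
derivatives of F. *)
Lemma riemann_coframe l k i j u : W u ->
  riemann G l k i j u = (invmx (F u) *m curvature_form i j u *m F u) l k.
Proof.
move=> Wu.
have -> : riemann G l k i j u =
    (dmx i (Ga j) u - dmx j (Ga i) u + (Ga i u *m Ga j u - Ga j u *m Ga i u)) l k.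
  rewrite /riemann -[partial i _ _]/(pd i (christoffel G l j k) u).
  rewrite -[partial j _ _]/(pd j (christoffel G l i k) u).
  have E a b : pd a (christoffel G l b k) u = dmx a (Ga b) u l k.
    rewrite mxE; apply: pd_near.
    by near=> x; apply: christoffel_coframe; near: x; exact: open_nbhs_nbhs.
  rewrite !E !mxE; congr (_ + _); rewrite sumrB; congr (_ - _);
    by apply: eq_bigr => a _; rewrite !christoffel_coframe.
congr (fun X : 'M[R]_n => X l k).
apply: (can_inj (mulKmx (uF Wu))).
rewrite -mulmxA mulKVmx ?uF// !(mulmxDr, mulmxN) !F_dGa// (ddF_sym i j)//.
move: (Ga i u) (Ga j u) => A B.
rewrite /curvature_form !(mulmxDl, mulNmx) !mulmxA.
by mx_abel.
Unshelve. all: by end_near.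
Qed.

(** Contracting with G^-1 in coordinates or with h^-1 in the coframe gives the
same number; Rm c d is the curvature evaluated on the c-th and d-th vectors of
the dual frame. *)
Lemma scal_coframe (Rm : 'I_n -> 'I_n -> 'M[R]_n) u : W u ->
  (forall i j, curvature_form i j u =
     \sum_c \sum_d (F u c i * F u d j) *: Rm c d) ->
  scal G u = \sum_d \sum_b invmx (h u) d b * \sum_c Rm c d c b.
Proof.
move=> Wu OmE.
have ricE j k : ricci G j k u = \sum_d F u d j * \sum_c (Rm c d *m F u) c k.
  transitivity (\sum_i \sum_c \sum_d
     F u d j * (F u c i * (invmx (F u) *m (Rm c d *m F u)) i k)).
    apply: eq_bigr => i _; rewrite riemann_coframe// OmE.
    rewrite mulmx_sumr mulmx_suml summxE; apply: eq_bigr => c _.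
    rewrite mulmx_sumr mulmx_suml summxE; apply: eq_bigr => d _.
    by rewrite -scalemxAr -scalemxAl mxE mulmxA (mulrC (F u c i)) mulrA.
  rewrite exchange_big/= [RHS](eq_bigr (fun d => \sum_c F u d j * (Rm c d *m F u) c k)).
    rewrite [RHS]exchange_big/=; apply: eq_bigr => c _; rewrite exchange_big/=.
    apply: eq_bigr => d _; rewrite -big_distrr/=; congr (_ * _).
    rewrite -[in RHS](mul1mx (Rm c d)) -(mulmxV (uF Wu)) -!mulmxA.
    by rewrite [in RHS]mxE.
  by move=> d _; rewrite big_distrr.
have FGF : F u *m invmx (G u) *m (F u)^T = invmx (h u).
  apply: (can_inj (mulmxK (uh Wu))); apply: (can_inj (mulmxK (uF Wu))).
  by rewrite mulVmx ?uh// mul1mx -!mulmxA (mulmxA _ (h u)) -GE// mulVmx ?uG// mulmx1.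
transitivity (\sum_d \sum_c (F u *m invmx (G u) *m (Rm c d *m F u)^T) d c).
  rewrite /scal; under eq_bigr => j _ do under eq_bigr => k _ do
    rewrite ricE big_distrr/=.
  under eq_bigr => j _ do rewrite exchange_big/=.
  rewrite exchange_big/=; apply: eq_bigr => d _.
  under [RHS]eq_bigr => c _ do rewrite mxE.
  rewrite [RHS]exchange_big/= exchange_big/=; apply: eq_bigr => k _.
  under [RHS]eq_bigr => c _ do rewrite [trmx _ _ _]mxE.
  rewrite -[RHS]big_distrr/= [in RHS]mxE mulr_suml.
  by apply: eq_bigr => j _; rewrite mulrCA mulrA.
apply: eq_bigr => d _.
under [RHS]eq_bigr => b _ do rewrite big_distrr/=.
rewrite [RHS]exchange_big/=; apply: eq_bigr => c _.
rewrite trmx_mul mulmxA FGF mxE; apply: eq_bigr => b _.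
by rewrite [trmx _ _ _]mxE.
Qed.
End Cartan.

(** * Metrics depending on one variable in an invariant coframe *)

Section CohomogeneityOne.
Variables (R : realType) (n : nat).
Local Notation V := 'rV[R]_n.+1.
Variables (K : 'I_n.+1 -> 'I_n.+1 -> 'I_n.+1 -> R) (K0 : 'I_n.+1 -> 'I_n.+1 -> R).
Variables (rho : 'M[R]_n.+1) (L L' : 'I_n.+1 -> R -> 'M[R]_n.+1) (h h' : R -> 'M[R]_n.+1).
Variables (W : set V) (G F : V -> 'M[R]_n.+1) (s : V -> R) (al : 'I_n.+1 -> V -> R).
Hypothesis oW : open W.
Hypothesis GE : forall u, W u -> G u = (F u)^T *m h (s u) *m F u.
Hypothesis uF : forall u, W u -> F u \in unitmx.
Hypothesis CF : forall a b, Ck W 3 (fun u => F u a b).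
Hypothesis ds : forall u, W u -> differentiable s u.
Hypothesis F0 : forall u i, W u -> F u ord0 i = pd i s u.
Hypothesis dal : forall u i, W u -> differentiable (al i) u.
(* The structure equations of the coframe F and of the isotropy component al:
   K and K0 are the components of brackets along the frame and along the
   isotropy algebra, and rho is the isotropy representation. *)
Hypothesis dF : forall u i j c, W u ->
  dmx i F u c j - dmx j F u c i =
  - (\sum_d \sum_e F u d i * F u e j * K d e c
     + al i u * (rho *m F u) c j - al j u * (rho *m F u) c i).
Hypothesis dalE : forall u i j, W u ->
  pd i (al j) u - pd j (al i) u = - \sum_d \sum_e F u d i * F u e j * K0 d e.
Hypothesis dL : forall u c a b, W u ->
  is_derive (s u) 1 (fun t => L c t a b) (L' c (s u) a b).
Hypothesis dh : forall u a b, W u ->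
  is_derive (s u) 1 (fun t => h t a b) (h' (s u) a b).
Hypothesis uh : forall u, W u -> h (s u) \in unitmx.
Hypothesis sh : forall u, W u -> (h (s u))^T = h (s u).
Hypothesis torsion : forall u c d a, W u ->
  L c (s u) a d - L d (s u) a c = K c d a.
Hypothesis compat : forall u c, W u ->
  (h (s u) *m L c (s u))^T + h (s u) *m L c (s u) = (c == ord0)%:R *: h' (s u).
Hypothesis compat_rho : forall u, W u ->
  (h (s u) *m rho)^T + h (s u) *m rho = 0.
(* Equivariance of L under the isotropy algebra: it makes the terms of the
   curvature that involve al cancel. *)
Hypothesis equiv : forall u c, W u ->
  rho *m L c (s u) - L c (s u) *m rho = \sum_e rho e c *: L e (s u).

(** The Levi-Civita connection form; the isotropy component enters through rho
only, as for a connection invariant under the group. *)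
Definition connection i u : 'M[R]_n.+1 :=
  \sum_c F u c i *: L c (s u) + al i u *: rho.

(** The curvature of the connection on the c-th and d-th frame vectors.  The
first line comes from the dependence on s (the coframe element of index 0 is
ds), the second from the brackets, the third from the commutator of the
connection matrices. *)
Definition frame_curvature t c d : 'M[R]_n.+1 :=
  (c == ord0)%:R *: L' d t - (d == ord0)%:R *: L' c t
  - (\sum_e K c d e *: L e t + K0 c d *: rho)
  + (L c t *m L d t - L d t *m L c t).

Let connectionE u i a b :
  connection i u a b = \sum_c F u c i * L c (s u) a b + al i u * rho a b.
Proof.
rewrite mxE summxE [in X in _ + X]mxE; congr (_ + _).
by apply: eq_bigr => c _; rewrite mxE.
Qed.

Let F_diff u c i : W u -> differentiable (fun x => F x c i) u.
Proof. by move=> Wu; apply: (Ck_differentiable (CF c i)). Qed.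

Let comp_diff u (f : R -> R) f' : W u -> is_derive (s u) 1 f f' ->
  differentiable (fun x => f (s x)) u.
Proof. by move=> Wu df; apply: differentiable_comp1; [exact: ds|]. Qed.

Let comp_pd i u (f : R -> R) f' : W u -> is_derive (s u) 1 f f' ->
  pd i (fun x => f (s x)) u = f' * F u ord0 i.
Proof.
move=> Wu df; rewrite pd_comp; [|exact: ds|by []].
by rewrite F0// derive1E derive_val.
Qed.

Let connection_diff i u : W u -> mx_differentiable (connection i) u.
Proof.
move=> Wu a b; have -> : (fun x => connection i x a b) =
   (fun x => \sum_c F x c i * L c (s x) a b + al i x * rho a b).
  by apply/funext => x; rewrite connectionE.
apply: differentiableD.
  apply: differentiable_bigsum => c; apply: differentiableM; first exact: F_diff.
  exact: (comp_diff Wu (dL c a b Wu)).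
by apply: differentiableM; [exact: dal|exact: differentiable_cst].
Qed.

Let dconnection i j u : W u -> dmx i (connection j) u =
  \sum_c dmx i F u c j *: L c (s u) + \sum_c (F u ord0 i * F u c j) *: L' c (s u)
  + pd i (al j) u *: rho.
Proof.
move=> Wu; apply/matrixP => a b; rewrite mxE.
have -> : (fun x => connection j x a b) =
   (fun x => \sum_c F x c j * L c (s x) a b + al j x * rho a b).
  by apply/funext => x; rewrite connectionE.
have d1 c : differentiable (fun x => L c (s x) a b) u.
  exact: (comp_diff Wu (dL c a b Wu)).
have d2 : differentiable (fun x => al j x * rho a b) u.
  by apply: differentiableM; [exact: dal|exact: differentiable_cst].
have d3 c : differentiable (fun x => F x c j * L c (s x) a b) u.
  by apply: differentiableM; [exact: F_diff|exact: d1].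
rewrite (pdD _ (differentiable_bigsum (index_enum _) d3) d2) (pd_sum _ d3).
rewrite (pdM _ (dal j Wu) (differentiable_cst _ _)) pd_cst mulr0 addr0.
rewrite [RHS]mxE [in X in _ = _ + X]mxE; congr (_ + _).
rewrite [RHS]mxE !summxE -big_split/=; apply: eq_bigr => c _.
rewrite (pdM _ (F_diff c j Wu) (d1 c)) (comp_pd i Wu (dL c a b Wu)).
rewrite [in RHS]mxE [in X in _ = X * _ + _]mxE [in X in _ = _ + X]mxE.
by congr (_ + _); ring.
Qed.

Let connection_torsion u i j a : W u ->
  (dmx i F u + connection i u *m F u) a j = (dmx j F u + connection j u *m F u) a i.
Proof.
move=> Wu; rewrite [LHS]mxE [RHS]mxE.
have E k l : (connection k u *m F u) a l =
    \sum_d \sum_e F u d k * F u e l * L d (s u) a e + al k u * (rho *m F u) a l.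
  rewrite mulmxDl mxE -scalemxAl [in X in _ + X]mxE; congr (_ + _).
  rewrite mulmx_suml summxE; apply: eq_bigr => d _.
  rewrite -scalemxAl mxE [in LHS]mxE big_distrr/=; apply: eq_bigr => e _; ring.
rewrite !E; apply/eqP; rewrite -subr_eq0; apply/eqP.
have -> : \sum_d \sum_e F u d j * F u e i * L d (s u) a e =
   \sum_d \sum_e F u d i * F u e j * L d (s u) a e
   - \sum_d \sum_e F u d i * F u e j * K d e a.
  rewrite exchange_big -sumrB; apply: eq_bigr => d _; rewrite -sumrB.
  by apply: eq_bigr => e _; rewrite -(torsion _ _ _ Wu); ring.
have := dF i j a Wu; move: (\sum_d _) (\sum_d _) (_ a j) (_ a i) (_ a j) (_ a i).
by move=> X Y Z T U U' H; move: (al i u) (al j u) H => a1 a2 H; lra.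
Qed.

Let connection_compat u i : W u -> dmx i (fun x => h (s x)) u =
  (h (s u) *m connection i u)^T + h (s u) *m connection i u.
Proof.
move=> Wu.
have -> : dmx i (fun x => h (s x)) u = F u ord0 i *: h' (s u).
  by apply/matrixP => a b; rewrite !mxE (comp_pd i Wu (dh a b Wu)) mulrC.
rewrite mulmxDr mulmx_sumr -scalemxAr raddfD raddf_sum/= linearZ/= addrACA.
rewrite -scalerDr compat_rho// scaler0 addr0 -big_split/= (bigD1 ord0)//= big1.
  rewrite -scalemxAr linearZ/= -scalerDr compat// eqxx scale1r addr0//.
move=> c c0; rewrite -scalemxAr linearZ/= -scalerDr compat// (negPf c0).
by rewrite scale0r scaler0.
Qed.

Let connection_curvature i j u : W u -> curvature_form connection i j u =
  \sum_c \sum_d (F u c i * F u d j) *: frame_curvature (s u) c d.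
Proof.
move=> Wu; rewrite /curvature_form !dconnection//.
pose A k := \sum_c F u c k *: L c (s u).
pose xy c d := F u c i * F u d j.
have rhoA k : rho *m A k - A k *m rho = \sum_c (rho *m F u) c k *: L c (s u).
  rewrite mulmx_sumr mulmx_suml -sumrB.
  under eq_bigr => c _ do
    rewrite -scalemxAr -scalemxAl -scalerBr equiv// scaler_sumr.
  rewrite exchange_big/=; apply: eq_bigr => c _; rewrite mxE scaler_suml.
  by apply: eq_bigr => d _; rewrite scalerA mulrC.
have dLE : \sum_c dmx i F u c j *: L c (s u) - \sum_c dmx j F u c i *: L c (s u)
    = - \sum_c \sum_d xy c d *: (\sum_e K c d e *: L e (s u))
      - al i u *: (rho *m A j - A j *m rho) + al j u *: (rho *m A i - A i *m rho).
  rewrite -sumrB; under eq_bigr => c _ do rewrite -scalerBl dF//.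
  have -> : \sum_c \sum_d xy c d *: (\sum_e K c d e *: L e (s u)) =
      \sum_e (\sum_c \sum_d xy c d * K c d e) *: L e (s u).
    under [RHS]eq_bigr => e _ do rewrite scaler_suml.
    rewrite [RHS]exchange_big/=; apply: eq_bigr => c _.
    under [RHS]eq_bigr => e _ do rewrite scaler_suml.
    rewrite [RHS]exchange_big/=; apply: eq_bigr => d _.
    by rewrite scaler_sumr; apply: eq_bigr => e _; rewrite scalerA.
  rewrite !rhoA !scaler_sumr -!sumrN -!big_split/=; apply: eq_bigr => c _.
  by rewrite !scalerA -![- (_ *: L _ _)]scaleNr -!scalerDl; congr (_ *: _); rewrite /xy; ring.
have dL'E : \sum_c (F u ord0 i * F u c j) *: L' c (s u)
    - \sum_c (F u ord0 j * F u c i) *: L' c (s u) =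
  \sum_c \sum_d xy c d *: ((c == ord0)%:R *: L' d (s u) - (d == ord0)%:R *: L' c (s u)).
  have -> : \sum_c (F u ord0 j * F u c i) *: L' c (s u) =
      \sum_c \sum_d (F u c i * F u d j * (d == ord0)%:R) *: L' c (s u).
    apply: eq_bigr => c _; rewrite (bigD1 ord0)//= ?eqxx mulr1 big1 ?addr0.
      by rewrite mulrC.
    by move=> d /negPf ->; rewrite mulr0 scale0r.
  have -> : \sum_c (F u ord0 i * F u c j) *: L' c (s u) =
      \sum_c \sum_d (F u c i * F u d j * (c == ord0)%:R) *: L' d (s u).
    rewrite [RHS](bigD1 ord0)//= [X in _ = _ + X]big1 ?addr0.
      by apply: eq_bigr => d _; rewrite ?eqxx mulr1.
    by move=> c /negPf ->; rewrite big1// => d _; rewrite mulr0 scale0r.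
  rewrite -sumrB; apply: eq_bigr => c _; rewrite -sumrB; apply: eq_bigr => d _.
  by rewrite scalerBr !scalerA.
have LLE : A i *m A j - A j *m A i =
   \sum_c \sum_d xy c d *: (L c (s u) *m L d (s u) - L d (s u) *m L c (s u)).
  have LL k l : A k *m A l =
      \sum_c \sum_d (F u c k * F u d l) *: (L c (s u) *m L d (s u)).
    rewrite mulmx_suml; apply: eq_bigr => c _.
    rewrite mulmx_sumr; apply: eq_bigr => d _.
    by rewrite -scalemxAl -scalemxAr scalerA.
  rewrite !LL [X in _ - X = _]exchange_big -sumrB; apply: eq_bigr => c _.
  rewrite -sumrB; apply: eq_bigr => d _.
  by rewrite scalerBr /xy (mulrC (F u d j)).
have -> : \sum_c \sum_d xy c d *: frame_curvature (s u) c d =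
   \sum_c \sum_d xy c d *: ((c == ord0)%:R *: L' d (s u) - (d == ord0)%:R *: L' c (s u))
   - \sum_c \sum_d xy c d *: (\sum_e K c d e *: L e (s u))
   - (\sum_c \sum_d xy c d * K0 c d) *: rho
   + \sum_c \sum_d xy c d *: (L c (s u) *m L d (s u) - L d (s u) *m L c (s u)).
  rewrite scaler_suml -!sumrB -big_split/=; apply: eq_bigr => c _.
  rewrite scaler_suml -!sumrB -big_split/=; apply: eq_bigr => d _.
  rewrite -(scalerA (xy c d)) -!scalerBr -scalerDr /frame_curvature opprD.
  by rewrite [in LHS](addrA (_ - _) (- _)).

rewrite -dL'E -LLE.
have dalE' := dalE i j Wu.
have -> : pd i (al j) u = pd j (al i) u - \sum_c \sum_d xy c d * K0 c d.
  by rewrite -dalE' addrCA subrr addr0.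
rewrite -(subrK (\sum_c dmx j F u c i *: L c (s u)) (\sum_c dmx i F u c j *: _)) dLE.
rewrite /connection -/(A i) -/(A j).
rewrite !(mulmxDl, mulmxDr) -!(scalemxAl, scalemxAr).
move: (\sum_c _) (\sum_c _) (\sum_c _) (\sum_c _) (A i) (A j).
move=> *.
by mx_abel.
Qed.

(** The connection form is torsion-free by the structure equation of F and
compatible with h; its curvature has no term in al by equivariance of L. *)
Lemma scal_cohomogeneity_one u : W u ->
  scal G u = \sum_d \sum_b invmx (h (s u)) d b *
     \sum_c frame_curvature (s u) c d c b.
Proof.
move=> Wu.
apply: (@scal_coframe _ _ G F (fun x => h (s x)) connection W) => //.
  by move=> x Wx a b; apply: (comp_diff Wx (dh a b Wx)).
by move=> i j; apply: connection_curvature.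
Qed.

End CohomogeneityOne.

(** * Connection and curvature of an invariant metric along the curve *)

Ltac tabsimp := cbn -[GRing.add GRing.mul GRing.opp GRing.zero GRing.one].

Section Tables.
Variable R : realType.

(** The unknowns of the Koszul equations: the free entries of connection matrices
for which equivariance under the isotropy algebra and, but for one relation
between kt1 and kt2, the vanishing of the torsion hold identically. *)
Record coefs := Coefs { ka : R; kb1 : R; kb2 : R; kb3 : R; kb4 : R;
  kp : R; kq : R; kw : R; kt1 : R; kt2 : R; kc1 : R; kc4 : R; kc5 : R; kc6 : R }.

(** Entry (a, b) of the connection matrix in the direction c, for the frame
xi, A, X_1, X_2, Y_1, Y_2 numbered from 0.  The constant part is multiplied by
one, so that the value 0 of this parameter yields the table of the derivatives. *)
Definition connection_tab (one : R) (k : coefs) (c a b : nat) : R :=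
  match c, a, b with
  | 0, 0, 0 | 0, 1, 1 | 1, 1, 0 => ka k
  | 1, 0, 1 => - ka k
  | 0, 2, 2 | 0, 3, 3 | 2, 2, 0 | 3, 3, 0 => kb1 k
  | 0, 2, 5 | 5, 2, 0 => kb2 k
  | 0, 3, 4 | 4, 3, 0 => - kb2 k
  | 0, 5, 2 | 2, 5, 0 => kb3 k
  | 0, 4, 3 | 3, 4, 0 => - kb3 k
  | 0, 4, 4 | 0, 5, 5 | 4, 4, 0 | 5, 5, 0 => kb4 k
  | 2, 0, 2 | 3, 0, 3 => kp k
  | 4, 0, 4 | 5, 0, 5 => kq k
  | 2, 0, 5 | 5, 0, 2 => kw k
  | 3, 0, 4 | 4, 0, 3 => - kw k
  | 2, 1, 4 | 3, 1, 5 => kt1 k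
  | 4, 1, 2 | 5, 1, 3 => kt2 k
  | 1, 3, 2 | 2, 3, 1 => kc1 k
  | 1, 2, 3 | 3, 2, 1 => - kc1 k
  | 1, 5, 4 | 4, 5, 1 => kc4 k
  | 1, 4, 5 | 5, 4, 1 => - kc4 k
  | 2, 4, 1 | 3, 5, 1 => kc5 k
  | 1, 4, 2 | 1, 5, 3 => kc5 k - one
  | 4, 2, 1 | 5, 3, 1 => kc6 k
  | 1, 2, 4 | 1, 3, 5 => kc6 k + one
  | _, _, _ => 0
  end.

(** The component along b_e of [b_c, b_d] for the basis d/dr, A, X_1, X_2, Y_1,
Y_2, E_12 of R x so(4), numbered from 0: index 6 is the isotropy component. *)
Definition structure_tab (c d e : nat) : R :=
  match c, d, e with
  | 4, 2, 1 | 5, 3, 1 | 2, 1, 4 | 3, 1, 5 | 1, 4, 2 | 1, 5, 3 | 3, 2, 6 | 5, 4, 6 => 1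
  | 2, 4, 1 | 3, 5, 1 | 1, 2, 4 | 1, 3, 5 | 4, 1, 2 | 5, 1, 3 | 2, 3, 6 | 4, 5, 6 => - 1
  | _, _, _ => 0
  end.

(** The matrix of ad E_12. *)
Definition isotropy_tab (a b : nat) : R :=
  match a, b with
  | 2, 3 | 4, 5 => 1
  | 3, 2 | 5, 4 => - 1
  | _, _ => 0
  end.

Definition metric_tab (V p q w : R) (a b : nat) : R :=
  match a, b with
  | 0, 0 | 1, 1 => V
  | 2, 2 | 3, 3 => p
  | 4, 4 | 5, 5 => q
  | 2, 5 | 5, 2 => w
  | 3, 4 | 4, 3 => - w
  | _, _ => 0
  end.

Definition curvature_tab (k k' : coefs) (c d a b : nat) : R :=
  (if c is 0 then connection_tab 0 k' d a b else 0)
  - (if d is 0 then connection_tab 0 k' c a b else 0)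
  - (\sum_(0 <= e < 6) structure_tab c d e * connection_tab 1 k e a b
     + structure_tab c d 6 * isotropy_tab a b)
  + \sum_(0 <= m < 6) (connection_tab 1 k c a m * connection_tab 1 k d m b
                       - connection_tab 1 k d a m * connection_tab 1 k c m b).

(** The solution of the Koszul equations for the Gram matrix metric_tab V p q w,
where V1, p1, q1, w1 are the derivatives of its entries. *)
Definition levi_civita_coefs (V p q w V1 p1 q1 w1 : R) : coefs :=
  let D := p * q - w ^+ 2 in
  Coefs (V1 / (2 * V)) ((q * p1 - w * w1) / (2 * D)) ((q * w1 - w * q1) / (2 * D))
   ((p * w1 - w * p1) / (2 * D)) ((p * q1 - w * w1) / (2 * D))
   (- p1 / (2 * V)) (- q1 / (2 * V)) (- w1 / (2 * V))
   ((p - q - V) / (2 * V)) ((p - q + V) / (2 * V))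
   (w * (V - p + q) / (2 * D)) (w * (V + p - q) / (2 * D))
   (p * (V - p + q) / (2 * D)) (- q * (V + p - q) / (2 * D)).

Definition ricci_tab k k' (d b : nat) := \sum_(0 <= c < 6) curvature_tab k k' c d c b.

Lemma sum6 (F : nat -> R) : \sum_(0 <= c < 6) F c =
  F 0%N + F 1%N + F 2%N + F 3%N + F 4%N + F 5%N.
Proof. by rewrite unlock /= addr0 !addrA. Qed.

(** The inverse Gram matrix has the same pattern of entries. *)
Definition metric_inv_tab (V p q w : R) (a b : nat) : R :=
  metric_tab V^-1 (q / (p * q - w ^+ 2)) (p / (p * q - w ^+ 2)) (- w / (p * q - w ^+ 2)) a b.

(** The derivative of levi_civita_coefs by the quotient rule. *)
Definition levi_civita_dcoefs (V p q w V1 p1 q1 w1 V2 p2 q2 w2 : R) : coefs :=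
  let D := p * q - w ^+ 2 in
  let D1 := p1 * q + p * q1 - 2 * w * w1 in
  let quot N N1 := N1 / (2 * D) - N * D1 / (2 * D ^+ 2) in
  let quotV N N1 := N1 / (2 * V) - N * V1 / (2 * V ^+ 2) in
  Coefs (quotV V1 V2)
   (quot (q * p1 - w * w1) (q1 * p1 + q * p2 - w1 * w1 - w * w2))
   (quot (q * w1 - w * q1) (q * w2 - w * q2))
   (quot (p * w1 - w * p1) (p * w2 - w * p2))
   (quot (p * q1 - w * w1) (p1 * q1 + p * q2 - w1 * w1 - w * w2))
   (quotV (- p1) (- p2)) (quotV (- q1) (- q2)) (quotV (- w1) (- w2))
   (quotV (p - q - V) (p1 - q1 - V1)) (quotV (p - q + V) (p1 - q1 + V1))
   (quot (w * (V - p + q)) (w1 * (V - p + q) + w * (V1 - p1 + q1)))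
   (quot (w * (V + p - q)) (w1 * (V + p - q) + w * (V1 + p1 - q1)))
   (quot (p * (V - p + q)) (p1 * (V - p + q) + p * (V1 - p1 + q1)))
   (quot (- q * (V + p - q)) (- q1 * (V + p - q) - q * (V1 + p1 - q1))).

Lemma ricci_tab_00 k k' : ricci_tab k k' 0 0 = - ka k' - 2 * (kb1 k' + kb4 k')
  + 2 * ka k * (kb1 k + kb4 k)
  - 2 * (kb1 k ^+ 2 + kb4 k ^+ 2 + 2 * kb2 k * kb3 k).
Proof. by rewrite /ricci_tab /curvature_tab !sum6; tabsimp; ring. Qed.

Lemma ricci_tab_11 k k' : ricci_tab k k' 1 1 = - ka k' - 2 * ka k * (kb1 k + kb4 k)
  + 2 * (kc1 k ^+ 2 + kc4 k ^+ 2 - 2 * kc5 k * kc6 k).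
Proof. by rewrite /ricci_tab /curvature_tab !sum6; tabsimp; ring. Qed.

Lemma ricci_tab_22 k k' d : d = 2%N \/ d = 3%N ->
  ricci_tab k k' d d = kp k' + 2 * (ka k + kb4 k) * kp k
  - 2 * kb3 k * kw k + kt1 k + kt2 k + 2 - kc5 k * (1 + kt1 k + kt2 k).
Proof. by case=> ->; rewrite /ricci_tab /curvature_tab !sum6; tabsimp; ring. Qed.

Lemma ricci_tab_44 k k' d : d = 4%N \/ d = 5%N ->
  ricci_tab k k' d d = kq k' + 2 * (ka k + kb1 k) * kq k
  - 2 * kb2 k * kw k - kt1 k - kt2 k + 2 + kc6 k * (1 - kt1 k - kt2 k).
Proof. by case=> ->; rewrite /ricci_tab /curvature_tab !sum6; tabsimp; ring. Qed.

Definition ricci_mixed1 k k' := kw k' + (2 * ka k + kb1 k + kb4 k) * kw k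
  - kp k * kb2 k - kq k * kb3 k + kt1 k * (kc4 k - kc1 k) + kc4 k.

Definition ricci_mixed2 k k' := kw k' + (2 * ka k + kb1 k + kb4 k) * kw k
  - kp k * kb2 k - kq k * kb3 k + kt2 k * (kc4 k - kc1 k) + kc1 k.

Lemma ricci_tab_25 k k' : ricci_tab k k' 2 5 = ricci_mixed1 k k'.
Proof. by rewrite /ricci_mixed1 /ricci_tab /curvature_tab !sum6; tabsimp; ring. Qed.

Lemma ricci_tab_52 k k' : ricci_tab k k' 5 2 = ricci_mixed2 k k'.
Proof. by rewrite /ricci_mixed2 /ricci_tab /curvature_tab !sum6; tabsimp; ring. Qed.

Lemma ricci_tab_34 k k' : ricci_tab k k' 3 4 = - ricci_mixed1 k k'.
Proof. by rewrite /ricci_mixed1 /ricci_tab /curvature_tab !sum6; tabsimp; ring. Qed.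

Lemma ricci_tab_43 k k' : ricci_tab k k' 4 3 = - ricci_mixed2 k k'.
Proof. by rewrite /ricci_mixed2 /ricci_tab /curvature_tab !sum6; tabsimp; ring. Qed.

(** The contracted curvature table in closed form.  The first term is the
curvature of the orbits; D is the determinant of the blocks of the Gram matrix
in X_i, Y_j, and H is the logarithmic derivative of the volume of the
orbits. *)
Lemma scal_tab (V p q w V1 p1 q1 w1 V2 p2 q2 w2 : R) :
  let D := p * q - w ^+ 2 in
  let D1 := p1 * q + p * q1 - 2 * w * w1 in
  let D2 := p2 * q + 2 * p1 * q1 + p * q2 - 2 * w1 ^+ 2 - 2 * w * w2 in
  let l := V1 / V in
  let H := l / 2 + D1 / D in
  let H1 := (V2 / V - l ^+ 2) / 2 + D2 / D - (D1 / D) ^+ 2 in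
  V != 0 -> D != 0 ->
  \sum_(0 <= d < 6) \sum_(0 <= b < 6) metric_inv_tab V p q w d b *
    ricci_tab (levi_civita_coefs V p q w V1 p1 q1 w1)
        (levi_civita_dcoefs V p q w V1 p1 q1 w1 V2 p2 q2 w2) d b =
  (4 * V * (p + q) - V ^+ 2 - (p - q) ^+ 2 - 2 * w ^+ 2 * V ^+ 2 / D) / (V * D)
  - (2 * H1 - l * H + H ^+ 2 + l ^+ 2 / 4
     + ((q * p1 - w * w1) ^+ 2 + (p * q1 - w * w1) ^+ 2
        + 2 * (q * w1 - w * q1) * (p * w1 - w * p1)) / (2 * D ^+ 2)) / V.
Proof.
move=> D D1 D2 l H H1 V0 D0.
set k := levi_civita_coefs _ _ _ _ _ _ _ _.
set k' := levi_civita_dcoefs _ _ _ _ _ _ _ _ _ _ _ _.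
rewrite !sum6 /metric_inv_tab; cbn [metric_tab].
rewrite !mul0r !addr0 !add0r ricci_tab_00 ricci_tab_11 !(ricci_tab_22 _ _ (or_introl erefl)).
rewrite !(ricci_tab_22 _ _ (or_intror erefl)) !(ricci_tab_44 _ _ (or_introl erefl)).
rewrite !(ricci_tab_44 _ _ (or_intror erefl)).
rewrite ricci_tab_25 ricci_tab_52 ricci_tab_34 ricci_tab_43.
rewrite /ricci_mixed1 /ricci_mixed2 /k /k' /levi_civita_coefs /levi_civita_dcoefs.
cbn [ka kb1 kb2 kb3 kb4 kp kq kw kt1 kt2 kc1 kc4 kc5 kc6].
rewrite /D2 /D1 /H /H1 /l /D2 /D1 -/D; move: D0; rewrite /D => D0.
by field; rewrite ?D0 ?V0.
Qed.
End Tables.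

Ltac each6 i := let j := fresh in case: i => [[|[|[|[|[|[|j]]]]]] ?] //.

Section TableIdentities.
Variable R : realType.
Implicit Types (k : coefs R).

Definition connection_mx one k (c : 'I_6) : 'M[R]_6 :=
  \matrix_(a, b) connection_tab one k c a b.
Definition isotropy_mx : 'M[R]_6 := \matrix_(a, b) isotropy_tab R a b.
Definition metric_mx (V p q w : R) : 'M[R]_6 := \matrix_(a, b) metric_tab V p q w a b.

(** Among the torsion equations only this one relates two coefficients; the
table is built so that the others hold identically. *)
Lemma connection_tab_torsion k (c d a : 'I_6) : kt2 k = kt1 k + 1 ->
  connection_tab 1 k c a d - connection_tab 1 k d a c = structure_tab R c d a.
Proof.
by move=> kE; each6 c; each6 d; each6 a; tabsimp; rewrite ?kE; ring.
Qed.

Lemma sum6_ord (F : nat -> R) : \sum_(c < 6) F c =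
  F 0%N + F 1%N + F 2%N + F 3%N + F 4%N + F 5%N.
Proof. by rewrite -(big_mkord xpredT) sum6. Qed.

Lemma connection_mx_equivariant k c :
  isotropy_mx *m connection_mx 1 k c - connection_mx 1 k c *m isotropy_mx =
  \sum_e isotropy_mx e c *: connection_mx 1 k e.
Proof.
apply/matrixP => a b; rewrite summxE !mxE.
under eq_bigr do rewrite !mxE.
under [X in _ - X]eq_bigr do rewrite !mxE.
under [RHS]eq_bigr do rewrite !mxE.
rewrite (sum6_ord (fun e => isotropy_tab R a e * connection_tab 1 k c e b)).
rewrite (sum6_ord (fun e => connection_tab 1 k c a e * isotropy_tab R e b)).
rewrite (sum6_ord (fun e => isotropy_tab R e c * connection_tab 1 k e a b)).
by each6 c; each6 a; each6 b; tabsimp; ring.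
Qed.

Lemma metric_mx_sym (V p q w : R) : (metric_mx V p q w)^T = metric_mx V p q w.
Proof. by apply/matrixP => a b; rewrite !mxE; each6 a; each6 b. Qed.

Lemma mul_metric_mxE (V p q w : R) (M : nat -> nat -> R) (a b : 'I_6) :
  (metric_mx V p q w *m \matrix_(c, d) M c d) a b =
  \sum_(0 <= e < 6) metric_tab V p q w a e * M e b.
Proof. by rewrite mxE big_mkord; apply: eq_bigr => e _; rewrite !mxE. Qed.

Lemma metric_mx_mul_inv (V p q w : R) : V != 0 -> p * q - w ^+ 2 != 0 ->
  metric_mx V p q w *m \matrix_(a, b) metric_inv_tab V p q w a b = 1%:M.
Proof.
move=> V0 D0; apply/matrixP => a b; rewrite mul_metric_mxE sum6 mxE.
by rewrite /metric_inv_tab; each6 a; each6 b; tabsimp; field; rewrite ?V0 ?D0.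
Qed.

Lemma metric_mx_unit (V p q w : R) : V != 0 -> p * q - w ^+ 2 != 0 ->
  metric_mx V p q w \in unitmx.
Proof. by move=> V0 D0; have /mulmx1_unit[] := metric_mx_mul_inv V0 D0. Qed.

Lemma metric_mx_inv (V p q w : R) : V != 0 -> p * q - w ^+ 2 != 0 ->
  invmx (metric_mx V p q w) = \matrix_(a, b) metric_inv_tab V p q w a b.
Proof.
move=> V0 D0; apply: (can_inj (mulKmx (metric_mx_unit V0 D0))).
by rewrite metric_mx_mul_inv// mulmxV// metric_mx_unit.
Qed.

Lemma metric_mx_rho (V p q w : R) :
  (metric_mx V p q w *m isotropy_mx)^T + metric_mx V p q w *m isotropy_mx = 0.
Proof.
apply/matrixP => a b; rewrite mxE [trmx _ _ _]mxE !mul_metric_mxE !sum6 mxE.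
by each6 a; each6 b; tabsimp; ring.
Qed.

(** The Koszul equations, cleared of denominators so that they are linear in the
coefficients. *)
Record metric_coefs (V p q w V1 p1 q1 w1 : R) k : Prop := MetricCoefs {
  mca : V * ka k = V1 / 2;
  mcb1 : p * kb1 k + w * kb3 k = p1 / 2;
  mcb2 : p * kb2 k + w * kb4 k = w1 / 2;
  mcb3 : w * kb1 k + q * kb3 k = w1 / 2;
  mcb4 : w * kb2 k + q * kb4 k = q1 / 2;
  mcp : V * kp k = - p1 / 2;
  mcq : V * kq k = - q1 / 2;
  mcw : V * kw k = - w1 / 2;
  mct1 : V * kt1 k = (p - q - V) / 2;
  mct2 : V * kt2 k = (p - q + V) / 2;
  mcc1 : p * kc1 k - w * kc5 k = 0;
  mcc4 : w * kc6 k + q * kc4 k = 0;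
  mcc5 : q * kc5 k - w * kc1 k = (V - p + q) / 2;
  mcc6 : p * kc6 k + w * kc4 k = - (V + p - q) / 2 }.

Lemma levi_civita_coefs_metric (V p q w V1 p1 q1 w1 : R) : V != 0 -> p * q - w ^+ 2 != 0 ->
  metric_coefs V p q w V1 p1 q1 w1 (levi_civita_coefs V p q w V1 p1 q1 w1).
Proof. by move=> V0 D0; split=> /=; field; rewrite ?V0 ?D0. Qed.

(** Each entry is a linear consequence of the Koszul equations. *)
Lemma metric_mx_compat (V p q w V1 p1 q1 w1 : R) k (c : 'I_6) :
  metric_coefs V p q w V1 p1 q1 w1 k ->
  (metric_mx V p q w *m connection_mx 1 k c)^T + metric_mx V p q w *m connection_mx 1 k c =
    (c == ord0)%:R *: metric_mx V1 p1 q1 w1.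
Proof.
case=> *; apply/matrixP => a b; rewrite mxE [trmx _ _ _]mxE.
rewrite !mul_metric_mxE !sum6 [RHS]mxE [in RHS]mxE -val_eqE /=.
by each6 c; each6 a; each6 b; tabsimp; first [ring | lra].
Qed.

Lemma frame_curvature_tab k k' t (c d a b : 'I_6) :
  frame_curvature (fun c d e : 'I_6 => structure_tab R c d e)
     (fun c d => structure_tab R c d 6) isotropy_mx
     (fun c _ => connection_mx 1 k c) (fun c _ => connection_mx 0 k' c) t c d a b =
  curvature_tab k k' c d a b.
Proof.
rewrite /frame_curvature /curvature_tab !big_mkord.
rewrite !(mxE, summxE); congr (_ - _ - (_ + _) + _).
- by rewrite -val_eqE; each6 c; rewrite /= ?mul1r ?mul0r.
- by rewrite -val_eqE; each6 d; rewrite /= ?mul1r ?mul0r.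
- by apply: eq_bigr => e _; rewrite !mxE.
- by rewrite -sumrB; apply: eq_bigr => e _; rewrite !mxE.
Qed.

End TableIdentities.

Section Derive1.
Variable R : realType.
Implicit Type t : R.
Local Notation D f t f' := (is_derive t (1 : R) f f').

Lemma der_cst (c t : R) : D (fun=> c) t 0.
Proof. exact: is_derive_cst. Qed.

Lemma der_eq (f : R -> R) t (f' f'' : R) : D f t f' -> f' = f'' -> D f t f''.
Proof. by move=> df <-. Qed.

Lemma derD (f g : R -> R) t (f' g' : R) : D f t f' -> D g t g' ->
  D (fun x => f x + g x) t (f' + g').
Proof. by move=> df dg; exact: is_deriveD. Qed.

Lemma derN (f : R -> R) t (f' : R) : D f t f' -> D (fun x => - f x) t (- f').
Proof. by move=> df; exact: is_deriveN. Qed.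

Lemma derB (f g : R -> R) t (f' g' : R) : D f t f' -> D g t g' ->
  D (fun x => f x - g x) t (f' - g').
Proof. by move=> df dg; exact: is_deriveB. Qed.

Lemma derM (f g : R -> R) t (f' g' : R) : D f t f' -> D g t g' ->
  D (fun x => f x * g x) t (f' * g t + f t * g').
Proof.
move=> df dg; apply: is_derive_eq; rewrite addrC.
by congr (_ + _); rewrite mulrC.
Qed.

Lemma derV (f : R -> R) t (f' : R) : D f t f' -> f t != 0 ->
  D (fun x => (f x)^-1) t (- f' / f t ^+ 2).
Proof.
move=> df f0; apply: DeriveDef; first exact: derivableV.
rewrite deriveV// derive_val /GRing.scale/=; by rewrite mulNr mulrC mulNr.
Qed.

Lemma der_half_quot (f g : R -> R) t (f' g' : R) :
  D f t f' -> D g t g' -> g t != 0 ->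
  D (fun x => f x / (2 * g x)) t (f' / (2 * g t) - f t * g' / (2 * g t ^+ 2)).
Proof.
move=> df dg g0; have d2 := derM (der_cst 2 t) dg.
have g2 : 2 * g t != 0 by rewrite mulf_neq0 // pnatr_eq0.
apply: (der_eq (derM df (derV d2 g2))).
by field; rewrite ?g0.
Qed.
End Derive1.

Section CoefsDerivable.
Variables (R : realType) (k : R -> coefs R) (k' : coefs R) (t : R).

Definition derivable_coef (pr : coefs R -> R) :=
  is_derive t (1 : R) (fun x => pr (k x)) (pr k').

Definition derivable_coefs :=
  derivable_coef (@ka R) /\ derivable_coef (@kb1 R)
  /\ derivable_coef (@kb2 R) /\ derivable_coef (@kb3 R) /\ derivable_coef (@kb4 R)
  /\ derivable_coef (@kp R) /\ derivable_coef (@kq R) /\ derivable_coef (@kw R)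
  /\ derivable_coef (@kt1 R) /\ derivable_coef (@kt2 R)
  /\ derivable_coef (@kc1 R) /\ derivable_coef (@kc4 R) /\ derivable_coef (@kc5 R)
  /\ derivable_coef (@kc6 R).

(** The table is affine in the coefficients, with the constants in the slots
scaled by the parameter one. *)
Lemma connection_tab_derive (c a b : nat) : derivable_coefs ->
  (c < 6)%N -> (a < 6)%N -> (b < 6)%N ->
  is_derive t (1 : R) (fun x => connection_tab 1 (k x) c a b) (connection_tab 0 k' c a b).
Proof.
move=> [da [db1 [db2 [db3 [db4 [dp [dq [dw [dt1 [dt2 [dc1 [dc4 [d5 d6]]]]]]]]]]]]].
have e5 := derB d5 (der_cst 1 t); have e6 := derD d6 (der_cst 1 t).
have z := der_cst 0 t.
have na := derN da; have nb2 := derN db2; have nb3 := derN db3.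
have nw := derN dw; have nc1 := derN dc1; have nc4 := derN dc4.
case: c => [|[|[|[|[|[|c]]]]]] //; case: a => [|[|[|[|[|[|a]]]]]] //;
case: b => [|[|[|[|[|[|b]]]]]] // _ _ _; assumption.
Qed.
End CoefsDerivable.

Section CoefsDerive.
Variables (R : realType) (V p q w V1 p1 q1 w1 : R -> R) (t V2 p2 q2 w2 : R).
Hypothesis dV : is_derive t (1 : R) V (V1 t).
Hypothesis dp : is_derive t (1 : R) p (p1 t).
Hypothesis dq : is_derive t (1 : R) q (q1 t).
Hypothesis dw : is_derive t (1 : R) w (w1 t).
Hypothesis dV1 : is_derive t (1 : R) V1 V2.
Hypothesis dp1 : is_derive t (1 : R) p1 p2.
Hypothesis dq1 : is_derive t (1 : R) q1 q2.
Hypothesis dw1 : is_derive t (1 : R) w1 w2.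
Hypothesis V0 : V t != 0.
Hypothesis D0 : p t * q t - w t ^+ 2 != 0.

Let k x := levi_civita_coefs (V x) (p x) (q x) (w x) (V1 x) (p1 x) (q1 x) (w1 x).
Let k' := levi_civita_dcoefs (V t) (p t) (q t) (w t) (V1 t) (p1 t) (q1 t) (w1 t) V2 p2 q2 w2.

Let dD : is_derive t (1 : R) (fun x => p x * q x - w x ^+ 2)
  (p1 t * q t + p t * q1 t - 2 * w t * w1 t).
Proof. by apply: (der_eq (derB (derM dp dq) (derM dw dw))); ring. Qed.

Let dVp := derB dp dq.

Ltac quot dN :=
  apply: (der_eq (der_half_quot dN dD D0)) ; congr (_ / _ - _ * _ / _); ring.

Lemma levi_civita_coefs_derivable : derivable_coefs k k' t.
Proof.
rewrite /derivable_coefs /derivable_coef /k /k' /levi_civita_coefs /levi_civita_dcoefs /=.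
repeat match goal with |- _ /\ _ => split end.
- exact: (der_half_quot dV1 dV V0).
- by quot (derB (derM dq dp1) (derM dw dw1)).
- by quot (derB (derM dq dw1) (derM dw dq1)).
- by quot (derB (derM dp dw1) (derM dw dp1)).
- by quot (derB (derM dp dq1) (derM dw dw1)).
- exact: (der_half_quot (derN dp1) dV V0).
- exact: (der_half_quot (derN dq1) dV V0).
- exact: (der_half_quot (derN dw1) dV V0).
- exact: (der_half_quot (derB dVp dV) dV V0).
- exact: (der_half_quot (derD dVp dV) dV V0).
- exact: (der_half_quot (derM dw (derD (derB dV dp) dq)) dD D0).
- exact: (der_half_quot (derM dw (derB (derD dV dp) dq)) dD D0).
- exact: (der_half_quot (derM dp (derD (derB dV dp) dq)) dD D0).
- by quot (derM (derN dq) (derB (derD dV dp) dq)).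
Qed.

End CoefsDerive.

(** * The Maurer-Cartan form of a lift to SO(4) *)

Section MaurerCartan.
Variables (R : realType) (n : nat).
Local Notation V := 'rV[R]_n.
Variables (W : set V) (P : V -> 'M[R]_4).
Hypothesis oW : open W.
Hypothesis PP : forall u, W u -> (P u)^T *m P u = 1%:M.
Hypothesis CP : forall m a b, Ck W m (fun u => P u a b).

(** The component along the i-th coordinate of P^-1 dP. *)
Definition mcform i u : 'M[R]_4 := (P u)^T *m dmx i P u.

Let P_diff u : W u -> mx_differentiable P u.
Proof. by move=> Wu a b; apply: (Ck_differentiable (CP 1 a b)). Qed.

Let dP_diff i u : W u -> mx_differentiable (dmx i P) u.
Proof.
move=> Wu a b; have := Ck_differentiable (Ck_pd i (CP 2 a b)) Wu.
by congr (differentiable _ _); apply/funext => x; rewrite mxE.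
Qed.

Lemma mcform_skew i u : W u -> (mcform i u)^T = - mcform i u.
Proof.
move=> Wu; apply/eqP; rewrite -subr_eq0 opprK; apply/eqP.
have <- : dmx i (fun x => (P x)^T *m P x) u = (mcform i u)^T + mcform i u.
  rewrite (dmxM _ (mx_differentiable_tr (P_diff Wu)) (P_diff Wu)) dmx_tr.
  by rewrite /mcform trmx_mul trmxK.
rewrite (@dmx_near _ _ _ _ _ _ (fun=> 1%:M)).
  by apply/matrixP => a b; rewrite !mxE pd_cst.
by near=> x; apply: PP; near: x; exact: open_nbhs_nbhs.
Unshelve. all: by end_near.
Qed.

Lemma Ck_mcform m i a b : Ck W m (fun u => mcform i u a b).
Proof.
have -> : (fun u => mcform i u a b) =
   (fun u => \sum_c P u c a * pd i (fun x => P x c b) u).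
  by apply/funext => u; rewrite mxE; apply: eq_bigr => c _; rewrite !mxE.
apply: Ck_sum => // c; apply: CkM => //; exact: Ck_pd (CP m.+1 c b).
Qed.

(** The Maurer-Cartan equation: differentiating P^T dP, the second derivatives of
P cancel by symmetry and dP^T dP equals minus the square of the form, since the
form is skew. *)
Lemma maurer_cartan i j u : W u ->
  dmx i (mcform j) u - dmx j (mcform i) u =
  - (mcform i u *m mcform j u - mcform j u *m mcform i u).
Proof.
move=> Wu.
have PPt : P u *m (P u)^T = 1%:M by apply: mulmx1C; apply: PP.
have dmc k l : dmx k (mcform l) u =
    - (mcform k u *m mcform l u) + (P u)^T *m dmx k (dmx l P) u.
  rewrite /mcform (dmxM _ (mx_differentiable_tr (P_diff Wu)) (dP_diff l Wu)) dmx_tr.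
  congr (_ + _); rewrite -[in RHS]mulNmx -(mcform_skew k Wu) /mcform trmx_mul trmxK.
  by rewrite mulmxA -(mulmxA _ (P u)) PPt mulmx1.
have ddP : dmx j (dmx i P) u = dmx i (dmx j P) u.
  apply/matrixP => a b; rewrite [LHS]mxE [RHS]mxE.
  have E k : (fun x => dmx k P x a b) = pd k (fun x => P x a b).
    by apply/funext => x; rewrite mxE.
  by rewrite (E i) (E j); exact: (pdC j i oW Wu (CP 3 a b)).
have dmc_ji := etrans (dmc j i) (congr1 (fun M => _ + _ *m M) ddP).
apply: etrans (congr2 (fun A B => A - B) (dmc i j) dmc_ji) _.
have cancel (M : zmodType) (x y z : M) : - x + z - (- y + z) = - (x - y).
  by rewrite opprD addrACA subrr addr0 opprD.
exact: cancel.
Qed.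

End MaurerCartan.

Section BracketTable.
Variable R : realType.
Implicit Types (x y : nat -> R) (a b : R).

(** The component along the c-th frame vector of the bracket of x + a E_12 and
y + b E_12, with x and y combinations of the frame vectors. *)
Definition bracket x y a b (c : nat) : R :=
  match c with
  | 0 => 0
  | 1 => x 4%N * y 2%N - x 2%N * y 4%N + (x 5%N * y 3%N - x 3%N * y 5%N)
  | 2 => x 1%N * y 4%N - x 4%N * y 1%N + (a * y 3%N - b * x 3%N)
  | 3 => x 1%N * y 5%N - x 5%N * y 1%N - (a * y 2%N - b * x 2%N)
  | 4 => x 2%N * y 1%N - x 1%N * y 2%N + (a * y 5%N - b * x 5%N)
  | _ => x 3%N * y 1%N - x 1%N * y 3%N - (a * y 4%N - b * x 4%N)
  end.

Lemma bracket_tab x y a b (c : 'I_6) :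
  \sum_(d < 6) \sum_(e < 6) x d * y e * structure_tab R d e c
  + a * (\sum_(e < 6) isotropy_tab R c e * y e) - b * (\sum_(e < 6) isotropy_tab R c e * x e)
  = bracket x y a b c.
Proof.
rewrite -!(big_mkord xpredT (fun e => isotropy_tab R c e * _ e)).
rewrite -(big_mkord xpredT (fun d => \sum_(e < 6) x d * y e * structure_tab R d e c)).
under eq_bigr => d _ do
  rewrite -(big_mkord xpredT (fun e => x d * y e * structure_tab R d e c)).
rewrite !sum6.
by case: c => [[|[|[|[|[|[|c]]]]]] cc] //; tabsimp; ring.
Qed.

Lemma bracket0_tab x y :
  \sum_(d < 6) \sum_(e < 6) x d * y e * structure_tab R d e 6
  = x 3%N * y 2%N - x 2%N * y 3%N + (x 5%N * y 4%N - x 4%N * y 5%N).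
Proof.
rewrite -(big_mkord xpredT (fun d => \sum_(e < 6) x d * y e * structure_tab R d e 6)).
under eq_bigr => d _ do
  rewrite -(big_mkord xpredT (fun e => x d * y e * structure_tab R d e 6)).
by rewrite !sum6; tabsimp; ring.
Qed.
End BracketTable.

Section FrameOfLift.
Variables (R : realType).
Local Notation V := 'rV[R]_6.
Variables (W : set V) (P : V -> 'M[R]_4) (s : V -> R).
Hypothesis oW : open W.
Hypothesis PP : forall u, W u -> (P u)^T *m P u = 1%:M.
Hypothesis CP : forall m a b, Ck W m (fun u => P u a b).
Hypothesis Cs : forall m, Ck W m s.

Local Notation o k := (@Ordinal 4 k isT).

(** ds followed by the components of the Maurer-Cartan form along E_34, E_13,
E_23, E_14, E_24. *)
Definition coframe_entry i u (c : nat) : R :=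
  match c with
  | 0 => pd i s u
  | 1 => mcform P i u (o 2) (o 3)
  | 2 => mcform P i u (o 0) (o 2)
  | 3 => mcform P i u (o 1) (o 2)
  | 4 => mcform P i u (o 0) (o 3)
  | _ => mcform P i u (o 1) (o 3)
  end.

Definition coframe u : 'M[R]_6 := \matrix_(c, i) coframe_entry i u c.
(** The component along E_12, the generator of the stabilizer of the curve. *)
Definition isotropy i u : R := mcform P i u (o 0) (o 1).

Lemma Ck_coframe m c i : Ck W m (fun u => coframe u c i).
Proof.
have -> : (fun u => coframe u c i) = (fun u => coframe_entry i u c).
  by apply/funext => u; rewrite mxE.
case: c => [[|[|[|[|[|c]]]]] cc] /=; try exact: Ck_mcform.
exact: Ck_pd.
Qed.

Lemma sum4 (M : nmodType) (F : 'I_4 -> M) : \sum_k F k = F (o 0) + F (o 1) + F (o 2) + F (o 3).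
Proof.
rewrite !big_ord_recl big_ord0 addr0 !addrA.
by congr (F _ + F _ + F _ + F _); apply: val_inj.
Qed.

Let mc_entry i j u a b : W u ->
  pd i (fun x => mcform P j x a b) u - pd j (fun x => mcform P i x a b) u =
  \sum_k (mcform P j u a k * mcform P i u k b
          - mcform P i u a k * mcform P j u k b).
Proof.
move=> Wu; have /(congr1 (fun A : 'M[R]_4 => A a b)) := maurer_cartan oW PP CP i j Wu.
rewrite !mxE => ->.
by rewrite opprB sumrB.
Qed.

Let mc_antisym i u a b : W u -> mcform P i u a b = - mcform P i u b a.
Proof.
move=> Wu; have /(congr1 (fun A : 'M[R]_4 => A b a)) := mcform_skew oW PP CP i Wu.
by rewrite [LHS]mxE [RHS]mxE.
Qed.

(** The entries of the Maurer-Cartan equation, and d(ds) = 0. *)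
Lemma coframe_structure u i j c : W u ->
  dmx i coframe u c j - dmx j coframe u c i =
  - (\sum_d \sum_e coframe u d i * coframe u e j * structure_tab R d e c
     + isotropy i u * (isotropy_mx R *m coframe u) c j
     - isotropy j u * (isotropy_mx R *m coframe u) c i).
Proof.
move=> Wu.
have E k l : dmx k coframe u c l = pd k (fun x => coframe_entry l x c) u.
  rewrite mxE; have -> // : (fun x => coframe x c l) = (fun x => coframe_entry l x c).
  by apply/funext => x; rewrite mxE.
apply: etrans (congr2 (fun A B => A - B) (E i j) (E j i)) _.
have -> : \sum_d \sum_e coframe u d i * coframe u e j * structure_tab R d e c
     + isotropy i u * (isotropy_mx R *m coframe u) c j
     - isotropy j u * (isotropy_mx R *m coframe u) c i =
   bracket (coframe_entry i u) (coframe_entry j u) (isotropy i u) (isotropy j u) c.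
  rewrite -bracket_tab !mxE; congr (_ + _ * _ - _ * _).
  - by apply: eq_bigr => d _; apply: eq_bigr => e _; rewrite !mxE.
  - by apply: eq_bigr => e _; rewrite !mxE.
  - by apply: eq_bigr => e _; rewrite !mxE.
rewrite /isotropy {E}.
case: c => [[|[|[|[|[|[|c]]]]]] cc] //; rewrite /bracket /coframe_entry.
  rewrite oppr0; apply/eqP; rewrite subr_eq0; apply/eqP.
  exact: (pdC i j oW Wu (Cs 3)).
all: rewrite (mc_entry _ _ _ _ Wu) sum4.
all: have := fun a b => mc_antisym i a b Wu; have := fun a b => mc_antisym j a b Wu.
all: move: (mcform P i u) (mcform P j u) => A B sB sA.
all: have dA a : A a a = 0 by have := sA a a; lra.
all: have dB a : B a a = 0 by have := sB a a; lra.
all: rewrite !(dA, dB) ?(sA (o 1) (o 0)) ?(sA (o 2) (o 0)) ?(sA (o 3) (o 0))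
 ?(sA (o 2) (o 1)) ?(sA (o 3) (o 1)) ?(sA (o 3) (o 2))
 ?(sB (o 1) (o 0)) ?(sB (o 2) (o 0)) ?(sB (o 3) (o 0))
 ?(sB (o 2) (o 1)) ?(sB (o 3) (o 1)) ?(sB (o 3) (o 2)) /=; ring.
Qed.

Lemma isotropy_structure u i j : W u ->
  pd i (isotropy j) u - pd j (isotropy i) u =
  - \sum_d \sum_e coframe u d i * coframe u e j * structure_tab R d e 6.
Proof.
move=> Wu.
have -> : \sum_d \sum_e coframe u d i * coframe u e j * structure_tab R d e 6 =
   \sum_(d < 6) \sum_(e < 6) coframe_entry i u d * coframe_entry j u e * structure_tab R d e 6.
  by apply: eq_bigr => d _; apply: eq_bigr => e _; rewrite !mxE.
rewrite bracket0_tab (mc_entry _ _ _ _ Wu) /coframe_entry.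
have := fun a b => mc_antisym i a b Wu; have := fun a b => mc_antisym j a b Wu.
rewrite sum4; move: (mcform P i u) (mcform P j u) => A B sB sA.
have dA a : A a a = 0 by have := sA a a; lra.
have dB a : B a a = 0 by have := sB a a; lra.
rewrite !(dA, dB) (sA (o 2) (o 1)) (sA (o 3) (o 1)) (sB (o 2) (o 1)) (sB (o 3) (o 1)).
ring.
Qed.

End FrameOfLift.

Section ScalLift.
Variables (R : realType).
Local Notation VV := 'rV[R]_6.
(* The functions carrying the index 1 or 2 are the first or second derivatives
   of V, p, q, w. *)
Variables (W : set VV) (P : VV -> 'M[R]_4) (s : VV -> R) (G : VV -> 'M[R]_6).
Variables V p q w V1 p1 q1 w1 V2 p2 q2 w2 : R -> R.
Hypothesis oW : open W.
Hypothesis PP : forall u, W u -> (P u)^T *m P u = 1%:M.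
Hypothesis CP : forall m a b, Ck W m (fun u => P u a b).
Hypothesis Cs : forall m, Ck W m s.
Hypothesis uF : forall u, W u -> coframe P s u \in unitmx.
Hypothesis GE : forall u, W u -> let t := s u in
  G u = (coframe P s u)^T *m metric_mx (V t) (p t) (q t) (w t) *m coframe P s u.
Hypothesis reg : forall u, W u -> let t := s u in
  [/\ V t != 0, p t * q t - w t ^+ 2 != 0,
   [/\ is_derive t (1 : R) V (V1 t), is_derive t (1 : R) p (p1 t),
       is_derive t (1 : R) q (q1 t) & is_derive t (1 : R) w (w1 t)] &
   [/\ is_derive t (1 : R) V1 (V2 t), is_derive t (1 : R) p1 (p2 t),
       is_derive t (1 : R) q1 (q2 t) & is_derive t (1 : R) w1 (w2 t)]].

Let k t := levi_civita_coefs (V t) (p t) (q t) (w t) (V1 t) (p1 t) (q1 t) (w1 t).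
Let k' t := levi_civita_dcoefs (V t) (p t) (q t) (w t) (V1 t) (p1 t) (q1 t) (w1 t)
                   (V2 t) (p2 t) (q2 t) (w2 t).
Let h t := metric_mx (V t) (p t) (q t) (w t).
Let h' t := metric_mx (V1 t) (p1 t) (q1 t) (w1 t).

Let derivable_h u a b : W u ->
  is_derive (s u) (1 : R) (fun t => h t a b) (h' (s u) a b).
Proof.
move=> /reg[_ _ [dV dp dq dw] _].
have -> : (fun t => h t a b) = (fun t => metric_tab (V t) (p t) (q t) (w t) a b).
  by apply/funext => t; rewrite mxE.
rewrite mxE; have z := der_cst 0 (s u); have nw := derN dw.
by case: a b => [[|[|[|[|[|[|a]]]]]] ?] [[|[|[|[|[|[|b]]]]]] ?].
Qed.

Let derivable_L u c a b : W u ->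
  is_derive (s u) (1 : R) (fun t => connection_mx 1 (k t) c a b)
    (connection_mx 0 (k' (s u)) c a b).
Proof.
move=> /reg[V0 D0 [dV dp dq dw] [dV1 dp1 dq1 dw1]].
have -> : (fun t => connection_mx 1 (k t) c a b) = (fun t => connection_tab 1 (k t) c a b).
  by apply/funext => t; rewrite mxE.
have dk := levi_civita_coefs_derivable dV dp dq dw dV1 dp1 dq1 dw1 V0 D0.
rewrite mxE; exact: (connection_tab_derive dk (ltn_ord c) (ltn_ord a) (ltn_ord b)).
Qed.

(** The Maurer-Cartan coframe has the structure equations, and the tables the
algebraic properties, of an invariant coframe with its Levi-Civita
connection. *)
Lemma scal_lift u : W u ->
  scal G u = \sum_(0 <= d < 6) \sum_(0 <= b < 6)
    metric_inv_tab (V (s u)) (p (s u)) (q (s u)) (w (s u)) d b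
    * ricci_tab (k (s u)) (k' (s u)) d b.
Proof.
move=> Wu; have [V0 D0 _ _] := reg Wu.
transitivity (\sum_d \sum_b invmx (h (s u)) d b * \sum_c frame_curvature
    (fun c d e : 'I_6 => structure_tab R c d e)
    (fun c d => structure_tab R c d 6) (isotropy_mx R)
    (fun c t => connection_mx 1 (k t) c) (fun c t => connection_mx 0 (k' t) c)
    (s u) c d c b); last first.
  rewrite big_mkord; apply: eq_bigr => d _; rewrite big_mkord.
  apply: eq_bigr => b _; rewrite metric_mx_inv// mxE; congr (_ * _).
  rewrite /ricci_tab big_mkord; apply: eq_bigr => c _.
  exact: (frame_curvature_tab (k (s u)) (k' (s u)) (s u) c d c b).
apply: (@scal_cohomogeneity_one R 5 (fun c d e => structure_tab R c d e)
  (fun c d => structure_tab R c d 6) (isotropy_mx R) (fun c t => connection_mx 1 (k t) c)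
  (fun c t => connection_mx 0 (k' t) c) h h' W G (coframe P s) s (isotropy P)) => //.
- by move=> a b; apply: Ck_coframe.
- by move=> x; apply: (Ck_differentiable (Cs 1)).
- by move=> x i Wx; rewrite mxE.
- by move=> x i; apply: (Ck_differentiable (Ck_mcform oW CP 1 i _ _)).
- by move=> x i j c; apply: coframe_structure.
- by move=> x i j; apply: isotropy_structure.
- by move=> x /reg[? ? _ _]; apply: metric_mx_unit.
- by move=> x _; apply: metric_mx_sym.
- move=> x c d a /reg[Vx0 _ _ _]; rewrite !mxE; apply: connection_tab_torsion.
  by rewrite /=; field.
- move=> x c /reg[Vx0 Dx0 _ _].
  exact: (metric_mx_compat c (levi_civita_coefs_metric _ _ _ _ Vx0 Dx0)).
- by move=> x _; apply: metric_mx_rho.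
- by move=> x c _; exact: (connection_mx_equivariant (k (s x)) c).
Qed.
End ScalLift.

(** * The frame along the curve *)

Section Frame.
Variable R : realType.

Lemma is_derive_scalel (V : normedModType R) (k : R -> R) (x : V) (t k' : R) :
  is_derive t (1 : R) k k' -> is_derive t (1 : R) (fun y => k y *: x) (k' *: x).
Proof.
move=> [dk dkE]; have Dk : differentiable k t by apply/derivable1_diffP.
apply: DeriveDef.
  by apply: diff_derivable; apply: differentiableZl.
by rewrite deriveE; [rewrite diffZl//= -deriveE// dkE|apply: differentiableZl].
Qed.

Lemma expr_cubic (B : 'M[R]_4) m : B ^+ 3 = - B ->
  B ^+ m.*2.+1 = (-1) ^+ m *: B /\ B ^+ m.*2.+2 = (-1) ^+ m *: (B ^+ 2).
Proof.
move=> B3; elim: m => [|m [IH1 IH2]]; first by rewrite !expr0 !scale1r.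
rewrite doubleS; split.
  rewrite exprSr IH2 -scalerAl -exprSr B3 scalerN -scaleNr exprS mulN1r //.
rewrite exprSr [B ^+ _.*2.+3]exprSr IH2 -scalerAl -exprSr B3 -scalerAl mulNr scalerN.
by rewrite -scaleNr exprS mulN1r expr2.
Qed.

Lemma exp_term_cubic (B : 'M[R]_4) t n : B ^+ 3 = - B ->
  (n`!%:R)^-1 *: ((t *: B) ^+ n : 'M[R]_4) =
  (n == 0%N)%:R *: (1 + B ^+ 2) + sin_coeff t n *: B - cos_coeff t n *: (B ^+ 2).
Proof.
move=> B3; rewrite exprZn /sin_coeff /cos_coeff /= -exprnP.
have [m [->|[->|->]]] : exists m, n = 0%N \/ n = m.*2.+1 \/ n = m.*2.+2.
  case: n => [|n]; first by exists 0%N; left.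
  exists n./2; right; case: (boolP (odd n)) => on.
    by right; rewrite -[in LHS](odd_double_half n) on.
  by left; rewrite -[in LHS](odd_double_half n) (negPf on).
- rewrite fact0 !expr0 !invr1 !mul0r !mulr1 !scale1r scale0r addr0 addrK //.
- have [-> _] := expr_cubic m B3.
  rewrite /= odd_double /= !mul0r !scale0r subr0 add0r !mul1r doubleK !scalerA.
  congr (_ *: _); move: (_^-1) (t ^+ _) (_ ^+ m) => x y z; ring.
- have [_ ->] := expr_cubic m B3.
  rewrite /= odd_double /= !mul0r !scale0r !add0r !mul1r doubleK !scalerA -scaleNr.
  congr (_ *: _); rewrite [(-1) ^+ m.+1]exprS.
  move: (_^-1) (t ^+ _) (_ ^+ m) => x y z; ring.
Qed.

(** Rodrigues' formula: if B^3 = - B, the odd powers of B are multiples of B and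
the even ones, from 2 on, multiples of B^2, and the exponential series splits
into the sine and cosine series. *)
Lemma expmx_cubic (B : 'M[R]_4) t : B ^+ 3 = - B ->
  expmx (t *: B) = 1 + B ^+ 2 + sin t *: B - cos t *: (B ^+ 2).
Proof.
move=> B3; rewrite /expmx; apply: cvg_lim => //.
have SE n : series (fun k => (k`!%:R)^-1 *: ((t *: B) ^+ k : 'M[R]_4)) n.+1 =
    1 + B ^+ 2 + series (sin_coeff t) n.+1 *: B - series (cos_coeff t) n.+1 *: (B ^+ 2).
  rewrite /series /=; under eq_bigr => k _ do rewrite exp_term_cubic//.
  rewrite !big_split/= sumrN -!scaler_suml; congr (_ + _ - _).
  by rewrite big_nat_recl// big1 ?addr0 ?scale1r.
rewrite -(cvg_shiftS (series _)); under eq_fun do rewrite SE.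
have cS : series (sin_coeff t) n.+1 @[n --> \oo] --> sin t.
  by rewrite unlock cvg_shiftS; exact: is_cvg_series_sin_coeff.
have cC : series (cos_coeff t) n.+1 @[n --> \oo] --> cos t.
  by rewrite unlock cvg_shiftS; exact: is_cvg_series_cos_coeff.
apply: cvgB; last exact: cvgZr_tmp.
apply: cvgD; [exact: cvg_cst|exact: cvgZr_tmp].
Qed.

(** The generators E_ij satisfy B^3 = - B, so that the explicit exponential is
all that is needed to differentiate the one-parameter group. *)
Lemma hat_cubic (B : 'M[R]_4) (p : C4 R) : B ^+ 3 = - B ->
  hat B p = (B *m p.1, B *m p.2).
Proof.
move=> B3; rewrite /hat.
have -> : (fun t : R => act (expmx (t *: B)) p) =
  (fun t => (((1 + B ^+ 2) *m p.1, (1 + B ^+ 2) *m p.2) : C4 R)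
     + sin t *: ((B *m p.1, B *m p.2) : C4 R)
     - cos t *: ((B ^+ 2 *m p.1, B ^+ 2 *m p.2) : C4 R)).
  apply/funext => t; rewrite expmx_cubic// /act.
  by congr (_, _); rewrite !(mulmxBl, mulmxDl) -!scalemxAl.
rewrite derive1E.
have dS := is_derive_scalel ((B *m p.1, B *m p.2) : C4 R) (is_derive_sin (0 : R)).
have dC := is_derive_scalel ((B ^+ 2 *m p.1, B ^+ 2 *m p.2) : C4 R) (is_derive_cos (0 : R)).
have dK := is_derive_cst (((1 + B ^+ 2) *m p.1, (1 + B ^+ 2) *m p.2) : C4 R) (0 : R) (1 : R).
have [_ ->] := is_deriveB (is_deriveD dK dS) dC.
by rewrite sin0 cos0 oppr0 scale0r subr0 scale1r add0r.
Qed.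

Local Notation o k := (@Ordinal 4 k isT).

Lemma E_delta (a b : 'I_4) : E R a.+1 b.+1 = delta_mx a b - delta_mx b a.
Proof. by apply/matrixP => c d; rewrite !mxE !eqSS. Qed.

Lemma E_cubic (a b : 'I_4) : a != b -> (E R a.+1 b.+1) ^+ 3 = - E R a.+1 b.+1.
Proof.
move=> ab; rewrite E_delta; set B := _ - _.
have ba : (b == a) = false by rewrite eq_sym; apply/negbTE.
have B2 : B * B = - (delta_mx a a + delta_mx b b).
  rewrite /B !mulrBl !mulrBr -!mulmxE !mul_delta_mx_cond ba (negPf ab) !eqxx.
  by rewrite !mulr0n !mulr1n sub0r subr0 opprD.
rewrite exprSr expr2 B2 /B mulNr mulrDl !mulrBr -!mulmxE !mul_delta_mx_cond.
by rewrite ba (negPf ab) !eqxx !mulr0n !mulr1n subr0 sub0r.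
Qed.

Lemma hat_E (a b : 'I_4) (p : C4 R) : a != b ->
  hat (E R a.+1 b.+1) p = (E R a.+1 b.+1 *m p.1, E R a.+1 b.+1 *m p.2).
Proof. by move=> ab; apply/hat_cubic/E_cubic. Qed.

Lemma e_delta (a : 'I_4) : e R a.+1 = delta_mx a 0.
Proof. by apply/matrixP => c d; rewrite !mxE ord1 eqSS andbT. Qed.

Lemma E_e (a b c : 'I_4) : E R a.+1 b.+1 *m e R c.+1 =
  (b == c)%:R *: e R a.+1 - (a == c)%:R *: e R b.+1.
Proof.
by rewrite E_delta !e_delta mulmxBl !mul_delta_mx_cond !scaler_nat.
Qed.

Lemma is_derive_cosh (r : R) : is_derive r (1 : R) (@cosh R) (sinh r).
Proof.
have dN : is_derive r (1 : R) (fun x : R => expR (- x)) (- expR (- r)).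
  have := @is_derive1_comp R expR -%R r (expR (- r)) (- 1) _ _.
  rewrite mulrN1; apply; exact: is_deriveNid.
apply: (der_eq (derM (derD (is_derive_expR r) dN) (der_cst 2^-1 r))).
by rewrite /sinh mulr0 addr0.
Qed.

Lemma is_derive_sinh (r : R) : is_derive r (1 : R) (@sinh R) (cosh r).
Proof.
have dN : is_derive r (1 : R) (fun x : R => expR (- x)) (- expR (- r)).
  have := @is_derive1_comp R expR -%R r (expR (- r)) (- 1) _ _.
  rewrite mulrN1; apply; exact: is_deriveNid.
apply: (der_eq (derM (derB (is_derive_expR r) dN) (der_cst 2^-1 r))).
by rewrite /cosh mulr0 addr0 opprK.
Qed.

Lemma derive1_gamma (r : R) :
  derive1 (@gamma R) r = (sinh r *: e R 4, cosh r *: e R 3).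
Proof.
have -> : @gamma R = (fun t => cosh t *: ((e R 4, 0) : C4 R)
    + sinh t *: ((0, e R 3) : C4 R)).
  apply/funext => t; rewrite /gamma; congr (_, _) => /=.
    by rewrite scaler0 addr0.
  by rewrite scaler0 add0r.
rewrite derive1E.
have d1 := is_derive_scalel ((e R 4, 0) : C4 R) (is_derive_cosh r).
have d2 := is_derive_scalel ((0, e R 3) : C4 R) (is_derive_sinh r).
have [_ ->] := is_deriveD d1 d2.
by congr (_, _); rewrite /= scaler0 ?addr0 ?add0r.
Qed.

(** The real and imaginary parts of the vector with coordinates a in the frame
at gamma r. *)
Definition framevec1 (r : R) (a : nat -> R) (k : nat) : R :=
  match k with 0 => cosh r * a 4%N | 1 => cosh r * a 5%N
             | 2 => cosh r * a 1%N | _ => sinh r * a 0%N end.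

Definition framevec2 (r : R) (a : nat -> R) (k : nat) : R :=
  match k with 0 => sinh r * a 2%N | 1 => sinh r * a 3%N
             | 2 => cosh r * a 0%N | _ => - sinh r * a 1%N end.

Lemma framevecE (r : R) (a : nat -> R) :
  framevec r (\row_k a k) =
  (\col_k framevec1 r a k, \col_k framevec2 r a k).
Proof.
rewrite /framevec.
have -> : \sum_(k < 6) (\row_k a k) 0 k *: tnth (frame r) k =
    \sum_(k < 6) a k *: nth 0 (frame r) k.
  by apply: eq_bigr => k _; rewrite mxE (tnth_nth 0).
rewrite -(big_mkord xpredT (fun k => a k *: nth 0 (frame r) k)) unlock /=.
rewrite derive1_gamma (hat_E _ (a := o 2) (b := o 3))//.
rewrite (hat_E _ (a := o 0) (b := o 2))// (hat_E _ (a := o 1) (b := o 2))//.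
rewrite (hat_E _ (a := o 0) (b := o 3))// (hat_E _ (a := o 1) (b := o 3))//.
rewrite /gamma /= -!scalemxAr.
rewrite !(E_e (o 2) (o 3) (o 3), E_e (o 2) (o 3) (o 2), E_e (o 0) (o 2) (o 3),
  E_e (o 0) (o 2) (o 2), E_e (o 1) (o 2) (o 3), E_e (o 1) (o 2) (o 2),
  E_e (o 0) (o 3) (o 3), E_e (o 0) (o 3) (o 2), E_e (o 1) (o 3) (o 3),
  E_e (o 1) (o 3) (o 2)).
rewrite [LHS]surjective_pairing; congr (_, _); apply/matrixP => k j /=.
  rewrite !mxE /=.
  by case: k => [[|[|[|[|k]]]] ?] //=; ring.
rewrite !mxE /=.
by case: k => [[|[|[|[|k]]]] ?] //=; ring.
Qed.
End Frame.

(** * Lifting a parametrization to SO(4) *)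

Section Cross4.
Variable R : realType.
Implicit Types f g h : nat -> R.

Definition dot4 f g := f 0%N * g 0%N + f 1%N * g 1%N + f 2%N * g 2%N + f 3%N * g 3%N.

(** The 3 x 3 minor of the columns f, g, h on the rows i, j, k. *)
Definition minor3 f g h (i j k : nat) :=
  f i * (g j * h k - g k * h j) - f j * (g i * h k - g k * h i)
  + f k * (g i * h j - g j * h i).

(** The vector orthogonal to f, g, h given by the signed 3 x 3 minors; it
completes three orthonormal vectors to an oriented orthonormal basis. *)
Definition cross4 f g h (a : nat) : R :=
  match a with
  | 0 => - minor3 f g h 1 2 3
  | 1 => minor3 f g h 0 2 3
  | 2 => - minor3 f g h 0 1 3
  | _ => minor3 f g h 0 1 2
  end.

(** The position of the columns is the one for which g and h are the images of
e_3 and e_4, the vectors that span the plane of gamma. *)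
Definition frame4 f g h : 'M[R]_4 := \matrix_(a, b)
  match val b with
  | 0 => f a | 1 => cross4 f g h a | 2 => g a | _ => h a
  end.

Lemma det_mx3 (B : 'M[R]_3) : let A i j := B (inord i) (inord j) in
  \det B = minor3 (A^~ 0%N) (A^~ 1%N) (A^~ 2%N) 0 1 2.
Proof.
move=> A; have AE i j : B i j = A i j by rewrite /A !inord_val.
do 2 rewrite ?(expand_det_row _ ord0) ?big_ord_recl ?big_ord0 /cofactor ?det_mx11 ?mxE.
rewrite !AE /= /bump /= !(addn0, add0n, add1n) /minor3; ring.
Qed.

Lemma det_mx4 (A : nat -> nat -> R) : \det (\matrix_(a < 4, b < 4) A a b) =
  A 0%N 1%N * - minor3 (A^~ 0%N) (A^~ 2%N) (A^~ 3%N) 1 2 3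
  + A 1%N 1%N * minor3 (A^~ 0%N) (A^~ 2%N) (A^~ 3%N) 0 2 3
  + A 2%N 1%N * - minor3 (A^~ 0%N) (A^~ 2%N) (A^~ 3%N) 0 1 3
  + A 3%N 1%N * minor3 (A^~ 0%N) (A^~ 2%N) (A^~ 3%N) 0 1 2.
Proof.
rewrite (expand_det_col _ (Ordinal (isT : 1 < 4)%N)) !big_ord_recl big_ord0 addr0 /cofactor.
rewrite !det_mx3 !mxE /minor3 !mxE /= !inordK//= /bump /= !(addn0, add0n, add1n, addn1).
ring.
Qed.

Lemma dot_cross4 f g h : [/\ dot4 (cross4 f g h) f = 0, dot4 (cross4 f g h) g = 0
  & dot4 (cross4 f g h) h = 0].
Proof. by rewrite /dot4 /cross4 /minor3; split; ring. Qed.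

Lemma dot4C f g : dot4 f g = dot4 g f.
Proof. rewrite /dot4; ring. Qed.

(** The Gram determinant of f, g, h. *)
Lemma cross4_norm f g h : dot4 (cross4 f g h) (cross4 f g h) =
  dot4 f f * dot4 g g * dot4 h h + 2 * dot4 f g * dot4 g h * dot4 f h
  - dot4 f f * dot4 g h ^+ 2 - dot4 g g * dot4 f h ^+ 2 - dot4 h h * dot4 f g ^+ 2.
Proof. rewrite /dot4 /cross4 /minor3; ring. Qed.

Lemma frame4_SO4 f g h : dot4 f f = 1 -> dot4 g g = 1 -> dot4 h h = 1 ->
  dot4 f g = 0 -> dot4 f h = 0 -> dot4 g h = 0 -> SO4 (frame4 f g h).
Proof.
move=> ff gg hh fg fh gh; have [cf cg ch] := dot_cross4 f g h.
have cc := cross4_norm f g h.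
rewrite ff gg hh fg fh gh !(mulr0, mul0r, addr0, subr0, mulr1, expr0n) in cc.
pose F (b : nat) a := match b with 0 => f a | 1 => cross4 f g h a | 2 => g a | _ => h a end.
split.
  apply/matrixP => a b; rewrite [LHS]mxE [RHS]mxE.
  have -> : \sum_c (frame4 f g h)^T a c * frame4 f g h c b = dot4 (F a) (F b).
    rewrite -[in RHS]/(dot4 _ _) /dot4 !big_ord_recl big_ord0 addr0 !addrA.
    by rewrite !mxE.
  case: a b => [[|[|[|[|a]]]] ?] [[|[|[|[|b]]]] ?] //=; rewrite /F ?(dot4C _ f) //.
  - by rewrite dot4C.
  - by rewrite dot4C.
  - by rewrite dot4C.
  - by rewrite dot4C.
by rewrite (det_mx4 (fun a b => F b a)) -cc.
Qed.
End Cross4.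

Section Components.
Variables (R : realType).
Local Notation V := 'rV[R]_6.

(** The real (b = false) or imaginary (b = true) part of an entry. *)
Definition component (b : bool) (j : 'I_4) (z : C4 R) : R := (if b then z.2 else z.1) j 0.

Lemma component_continuous b j : continuous (component b j).
Proof.
move=> z; rewrite /component; case: b.
  apply: (@continuous_comp _ _ _ (fun z : C4 R => z.2) (fun M : 'cV[R]_4 => M j 0)).
    exact: cvg_snd.
  exact: coord_continuous.
apply: (@continuous_comp _ _ _ (fun z : C4 R => z.1) (fun M : 'cV[R]_4 => M j 0)).
  exact: cvg_fst.
exact: coord_continuous.
Qed.

Lemma component_is_linear b j : linear (component b j : C4 R -> R^o).
Proof. by move=> k x y; rewrite /component; case: b; rewrite /= !mxE. Qed.

HB.instance Definition _ b j :=
  GRing.isLinear.Build R (C4 R) R^o *:%R (component b j) (component_is_linear b j).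

Lemma component_differentiable b j z : differentiable (component b j) z.
Proof.
apply: (@linear_differentiable R (C4 R) R^o (component b j)).
exact: component_continuous.
Qed.

Lemma pd_component b j (phi : V -> C4 R) u i : differentiable phi u ->
  differentiable (fun x => component b j (phi x)) u /\
  pd i (fun x => component b j (phi x)) u = component b j (partial i phi u).
Proof.
move=> dphi; have dl := component_differentiable b j (phi u).
have dc : differentiable (component b j \o phi) u by exact: differentiable_comp.
split; first exact: dc.
Transparent pd.
rewrite /pd /partial; transitivity ('d (component b j \o phi) u (delta_mx 0 i)).
  exact: (@deriveE _ _ R^o).
rewrite diff_comp//= (@deriveE _ _ _ phi)//.
rewrite (@diff_lin R (C4 R) R^o (component b j))//; exact: component_continuous.
Qed.
Opaque pd.

Lemma Ck_component (U : set V) (phi : V -> C4 R) n b j : open U ->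
  smooth_on U phi -> Ck U n (fun x => component b j (phi x)).
Proof.
move=> oU sphi.
suff H l : Ck U n (fun x => component b j (foldr (@partial R 6 (C4 R)) phi l x)).
  exact: (H [::]).
elim: n l => [//|n IH] l; split=> [u Uu|i].
  by have [] := pd_component b j ord0 (sphi l u Uu).
apply: (Ck_eq oU _ (IH (i :: l))) => u Uu.
by have [_ ->] := pd_component b j i (sphi l u Uu).
Qed.

End Components.

Section Lift.
Variables (R : realType).
Local Notation V := 'rV[R]_6.
Local Notation o k := (@Ordinal 4 k isT).

(** The square root of positive numbers, written so that its smoothness follows
from that of exp and ln. *)
Definition sqr_root (a : R) := expR (ln a / 2).

Lemma sqr_rootE (b : R) : 0 < b -> sqr_root (b ^+ 2) = b.
Proof.
by move=> b0; rewrite /sqr_root lnXn// -[ln b *+ 2]mulr_natr mulfK ?pnatr_eq0// lnK.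
Qed.

Lemma sqr_root_gt0 a : 0 < sqr_root a.
Proof. exact: expR_gt0. Qed.

Lemma sqr_rootK a : 0 < a -> sqr_root a ^+ 2 = a.
Proof.
move=> a0; rewrite /sqr_root expr2 -expRD -splitr lnK//.
Qed.

Lemma sinh_gt0 (t : R) : 0 < t -> 0 < sinh t.
Proof.
by move=> t0; rewrite /sinh divr_gt0// subr_gt0 ltr_expR; lra.
Qed.

Lemma cosh_gt0 (t : R) : 0 < cosh t.
Proof. by rewrite /cosh divr_gt0// addr_gt0// expR_gt0. Qed.

Lemma coshDsinh (t : R) : cosh t + sinh t = expR t.
Proof. by rewrite /cosh /sinh; field. Qed.

Lemma SO4_dot (P : 'M[R]_4) (a b : 'I_4) : SO4 P ->
  dot4 (fun k => P (inord k) a) (fun k => P (inord k) b) = (a == b)%:R.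
Proof.
move=> [PP _]; have /(congr1 (fun A : 'M[R]_4 => A a b)) := PP.
rewrite [LHS]mxE [RHS]mxE => <-.
rewrite sum4 /dot4 !mxE.
by congr (P _ _ * P _ _ + P _ _ * P _ _ + P _ _ * P _ _ + P _ _ * P _ _);
  apply: val_inj; rewrite /= inordK.
Qed.

Lemma mul_e (P : 'M[R]_4) (k : R) (a j : 'I_4) :
  (P *m (k *: e R a.+1)) j 0 = k * P j a.
Proof.
rewrite -scalemxAr mxE e_delta mxE (bigD1 a)//= mxE !eqxx mulr1 big1 ?addr0//.
by move=> i ia; rewrite mxE (negPf ia) mulr0.
Qed.

Lemma gram_schmidt4 (g h f : nat -> R) (q : R) :
  dot4 g g = 1 -> dot4 h h = 1 -> dot4 g h = 0 ->
  q != 0 -> q ^+ 2 = 1 - g 0%N ^+ 2 - h 0%N ^+ 2 ->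
  (forall k, f k = ((k == 0%N)%:R - g 0%N * g k - h 0%N * h k) / q) ->
  [/\ dot4 f f = 1, dot4 f g = 0 & dot4 f h = 0].
Proof.
move=> gg hh gh q0 qE fE.
have ff : dot4 f f = (1 - (2 - dot4 g g) * g 0%N ^+ 2 - (2 - dot4 h h) * h 0%N ^+ 2
    + 2 * g 0%N * h 0%N * dot4 g h) / q ^+ 2.
  by rewrite {1}/dot4 !fE /= /dot4; field.
have fg : dot4 f g = (g 0%N * (1 - dot4 g g) - h 0%N * dot4 g h) / q.
  by rewrite {1}/dot4 !fE /= /dot4; field.
have fh : dot4 f h = (h 0%N * (1 - dot4 h h) - g 0%N * dot4 g h) / q.
  by rewrite {1}/dot4 !fE /= /dot4; field.
rewrite ff fg fh gg hh gh subrr !mulr0 subr0 mul0r addr0; split=> //.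
have -> : 1 - (2 - 1) * g 0%N ^+ 2 - (2 - 1) * h 0%N ^+ 2 = q ^+ 2 by rewrite qE; ring.
by rewrite divff// expf_neq0.
Qed.

Variables (rho : \bar R) (U : set V) (phi : V -> C4 R).
Hypothesis pphi : parametrization (tube rho) U phi.

Let oU : open U. Proof. by have [] := pphi. Qed.

(* For z = P . gamma t the real part x of z is cosh t P e_4 and the imaginary
   part y is sinh t P e_3: they determine t, P e_3 and P e_4.  The first column
   is obtained by Gram-Schmidt from e_1, which requires that e_1 be outside of
   the span of the other two, that is m > 0. *)
Let x u (k : nat) := component false (inord k) (phi u).
Let y u (k : nat) := component true (inord k) (phi u).

Let tubeE u P t : SO4 P -> 0 < t -> phi u = act P (gamma t) ->
  [/\ dot4 (x u) (x u) = cosh t ^+ 2, dot4 (y u) (y u) = sinh t ^+ 2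
    & dot4 (y u) (x u) = 0].
Proof.
move=> SP t0 phiE.
have xE k : x u k = cosh t * P (inord k) (o 3).
  by rewrite /x /component phiE /= (mul_e _ _ (o 3)).
have yE k : y u k = sinh t * P (inord k) (o 2).
  by rewrite /y /component phiE /= (mul_e _ _ (o 2)).
pose c (a : 'I_4) k := P (inord k) a.
have e1 : dot4 (c (o 2)) (c (o 3)) = 0 by rewrite SO4_dot.
have e2 : dot4 (c (o 2)) (c (o 2)) = 1 by rewrite SO4_dot.
have e3 : dot4 (c (o 3)) (c (o 3)) = 1 by rewrite SO4_dot.
have scale (k l : R) a b : dot4 (fun i => k * c a i) (fun i => l * c b i) =
    k * l * dot4 (c a) (c b) by rewrite /dot4; ring.
have -> : x u = (fun k => cosh t * c (o 3) k) by apply/funext => k; rewrite xE.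
have -> : y u = (fun k => sinh t * c (o 2) k) by apply/funext => k; rewrite yE.
by rewrite !scale e1 e2 e3 mulr0 !mulr1 !expr2.
Qed.

Let nx u := dot4 (x u) (x u).
Let ny u := dot4 (y u) (y u).
Let g u k := y u k / sqr_root (ny u).
Let h u k := x u k / sqr_root (nx u).
Let m u := 1 - g u 0%N ^+ 2 - h u 0%N ^+ 2.
Let f u (k : nat) := ((k == 0)%:R - g u 0%N * g u k - h u 0%N * h u k) / sqr_root (m u).
(* cosh t + sinh t = exp t *)
Let s u := ln (sqr_root (nx u) + sqr_root (ny u)).
Let W := U `&` [set u | 0 < m u].

Let U_tube u : U u -> exists P t, [/\ SO4 P, 0 < t, (t%:E < rho)%E & phi u = act P (gamma t)].
Proof. by have [_ + _ _] := pphi; apply. Qed.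

Let sE u P t : SO4 P -> 0 < t -> phi u = act P (gamma t) ->
  [/\ sqr_root (nx u) = cosh t, sqr_root (ny u) = sinh t & s u = t].
Proof.
move=> SP t0 phiE; have [nxE nyE _] := tubeE SP t0 phiE.
have e1 : sqr_root (nx u) = cosh t by rewrite /nx nxE sqr_rootE// cosh_gt0.
have e2 : sqr_root (ny u) = sinh t by rewrite /ny nyE sqr_rootE// sinh_gt0.
by split=> //; rewrite /s e1 e2 coshDsinh expRK.
Qed.

Let Cx n k : Ck U n (fun u => x u k).
Proof. by have [_ _ sm _] := pphi; apply: Ck_component. Qed.

Let Cy n k : Ck U n (fun u => y u k).
Proof. by have [_ _ sm _] := pphi; apply: Ck_component. Qed.

Let Ck_dot4 (W' : set V) n (a b : V -> nat -> R) : open W' ->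
  (forall k, Ck W' n (fun u => a u k)) -> (forall k, Ck W' n (fun u => b u k)) ->
  Ck W' n (fun u => dot4 (a u) (b u)).
Proof.
by move=> oW' Ca Cb; rewrite /dot4; do 3 (apply: CkD => //; last by apply: CkM); apply: CkM.
Qed.

Let Ck_sqr_root (W' : set V) n (a : V -> R) : open W' ->
  (forall u, W' u -> 0 < a u) -> Ck W' n a -> Ck W' n (fun u => sqr_root (a u)).
Proof.
move=> oW' a0 Ca; apply: Ck_exp => //; apply: CkM => //; last exact: Ck_cst.
exact: Ck_ln.
Qed.

Let nx_gt0 u : U u -> 0 < nx u.
Proof.
move=> /U_tube[P [t [SP t0 _ phiE]]]; have [nxE _ _] := tubeE SP t0 phiE.
by rewrite /nx nxE exprn_gt0// cosh_gt0.
Qed.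

Let ny_gt0 u : U u -> 0 < ny u.
Proof.
move=> /U_tube[P [t [SP t0 _ phiE]]]; have [_ nyE _] := tubeE SP t0 phiE.
by rewrite /ny nyE exprn_gt0// sinh_gt0.
Qed.

Let sqr_root_neq0 a : sqr_root a != 0. Proof. by rewrite gt_eqF// sqr_root_gt0. Qed.

Let Cg n k : Ck U n (fun u => g u k).
Proof.
apply: CkM => //; apply: Ck_inv => //; apply: Ck_sqr_root => //; exact: Ck_dot4.
Qed.

Let Ch n k : Ck U n (fun u => h u k).
Proof.
apply: CkM => //; apply: Ck_inv => //; apply: Ck_sqr_root => //; exact: Ck_dot4.
Qed.

Let Cm n : Ck U n m.
Proof.
do 2 (apply: CkB => //; last by apply: CkM).
exact: Ck_cst.
Qed.

Let oW : open W.
Proof.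
rewrite openE => u [Uu mu]; apply: filterI; first exact: open_nbhs_nbhs.
have /differentiable_continuous c := Ck_differentiable (Cm 1) Uu.
exact: (cvgr_gt (m u) c).
Qed.

Let Cf n k : Ck W n (fun u => f u k).
Proof.
have WU : W `<=` U by move=> u [].
apply: CkM => //; last first.
  apply: Ck_inv => //; apply: Ck_sqr_root => //; first by move=> u [].
  exact: Ck_subset (Cm n).
apply: (Ck_subset WU).
apply: CkB => //; last by apply: CkM.
by apply: CkB => //; [exact: Ck_cst|apply: CkM].
Qed.

Let Cs n : Ck W n s.
Proof.
have WU : W `<=` U by move=> u [].
apply: (Ck_subset WU); apply: Ck_ln => //.
  by move=> u _; rewrite addr_gt0// sqr_root_gt0.
by apply: CkD => //; apply: Ck_sqr_root => //; exact: Ck_dot4.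
Qed.

Let P u := frame4 (f u) (g u) (h u).

Let SO4_P u : W u -> SO4 (P u).
Proof.
move=> [Uu mu].
have [P0 [t [SP t0 _ phiE]]] := U_tube Uu.
have [_ _ yx] := tubeE SP t0 phiE.
have nx0 : sqr_root (nx u) ^+ 2 = nx u by rewrite sqr_rootK// nx_gt0.
have ny0 : sqr_root (ny u) ^+ 2 = ny u by rewrite sqr_rootK// ny_gt0.
have m0 : sqr_root (m u) ^+ 2 = m u by rewrite sqr_rootK.
have gg : dot4 (g u) (g u) = 1.
  transitivity (ny u / sqr_root (ny u) ^+ 2); first by rewrite /g /ny /dot4; field.
  by rewrite ny0 divff// gt_eqF// ny_gt0.
have hh : dot4 (h u) (h u) = 1.
  transitivity (nx u / sqr_root (nx u) ^+ 2); first by rewrite /h /nx /dot4; field.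
  by rewrite nx0 divff// gt_eqF// nx_gt0.
have gh : dot4 (g u) (h u) = 0.
  transitivity (dot4 (y u) (x u) / (sqr_root (ny u) * sqr_root (nx u))).
    by rewrite /g /h /dot4; field; rewrite !sqr_root_neq0.
  by rewrite yx mul0r.
have [ff fg fh] := gram_schmidt4 gg hh gh (sqr_root_neq0 _) m0 (fun k => erefl (f u k)).
exact: frame4_SO4.
Qed.

(** At u0 the vectors P e_3 and P e_4 are e_3 and e_4, so Gram-Schmidt started
from e_1 succeeds on a neighbourhood; the second column is forced by the
orientation. *)
Lemma local_lift u0 r : U u0 -> 0 < r -> phi u0 = gamma r ->
  exists W P s, [/\ [/\ open W, W u0, W `<=` U & s u0 = r],
    forall n a b, Ck W n (fun u => (P u : 'M[R]_4) a b),
    forall n, Ck W n s &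
    forall u, W u -> [/\ SO4 (P u), 0 < s u, ((s u)%:E < rho)%E &
                        phi u = act (P u) (gamma (s u))]].
Proof.
move=> Uu0 r0 phi0; exists W, P, s.
have S1 : SO4 (1%:M : 'M[R]_4) by split; rewrite ?trmx1 ?mulmx1 ?det1.
have phi1 : phi u0 = act 1%:M (gamma r) by rewrite phi0 /act !mul1mx -surjective_pairing.
split=> [| n a b | // |u Wu].
- have [nx0 ny0 s0] := sE S1 r0 phi1; split=> //; last by move=> u [].
  split=> //=.
  have x0 : x u0 0%N = 0.
    rewrite /x /component phi0 /= !mxE /= inordK//= mulr0 //.
  have y0 : y u0 0%N = 0.
    rewrite /y /component phi0 /= !mxE /= inordK//= mulr0 //.
  by rewrite /m /g /h x0 y0 !mul0r expr0n /= !subr0.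
- have -> : (fun u => P u a b) = (fun u => match val b with
    | 0 => f u a | 1 => cross4 (f u) (g u) (h u) a | 2 => g u a | _ => h u a end).
    by apply/funext => u; rewrite mxE.
  have WU : W `<=` U by move=> ? [].
  have CgW k := Ck_subset WU (Cg n k); have ChW k := Ck_subset WU (Ch n k).
  have CfW k := Cf n k.
  have Cminor i j k : Ck W n (fun u => minor3 (f u) (g u) (h u) i j k).
    rewrite /minor3; apply: CkD => //; last first.
      by apply: CkM => //; apply: CkB => //; apply: CkM.
    by apply: CkB => //; apply: CkM => //; apply: CkB => //; apply: CkM.
  case: b => [[|[|[|[|b]]]] ?] //=.
  case: a => [[|[|[|[|a]]]] ?] //=; first [exact: Cminor|apply: (CkN oW); exact: Cminor].
- have [Uu _] := Wu; have [P0 [t [SP0 t0 trho phiE]]] := U_tube Uu.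
  have [nxt nyt st] := sE SP0 t0 phiE; rewrite st; split=> //; first exact: SO4_P.
  rewrite [LHS]surjective_pairing; congr (_, _) => /=; apply/matrixP => j k;
    rewrite ord1.
    rewrite (mul_e _ _ (o 3)) mxE /= /h nxt /x /component inord_val.
    by rewrite mulrC divfK// gt_eqF// cosh_gt0.
  rewrite (mul_e _ _ (o 2)) mxE /= /g nyt /y /component inord_val.
  by rewrite mulrC divfK// gt_eqF// sinh_gt0.
Qed.

End Lift.

(** * The pulled back metric in the coframe of a lift *)

Section Pullback.
Variables (R : realType).
Local Notation VV := 'rV[R]_6.
Local Notation o k := (@Ordinal 4 k isT).

Lemma C4_eq (z z' : C4 R) : (forall b j, component b j z = component b j z') -> z = z'.
Proof.
move=> H; rewrite (surjective_pairing z) (surjective_pairing z').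
congr (_, _); apply/matrixP => j k; rewrite ord1.
  exact: (H false j).
exact: (H true j).
Qed.

Lemma component_act b j (P : 'M[R]_4) z : component b j (act P z) =
  \sum_k P j k * component b k z.
Proof. by case: b; rewrite /component /act /= mxE. Qed.

Lemma component_framevec b (j : 'I_4) r (a : nat -> R) :
  component b j (framevec r (\row_k a k)) = (if b then framevec2 r a j else framevec1 r a j).
Proof. by rewrite framevecE /component; case: b; rewrite /= mxE. Qed.

Lemma tangent_framevec (r : R) (a : nat -> R) :
  tangentQ3 (gamma r) (framevec r (\row_k a k)).
Proof.
rewrite /tangentQ3 /= sum4.
have E j : entry (framevec r (\row_k a k)) j =
   (framevec1 r a j +i* framevec2 r a j)%C.
  by rewrite framevecE /entry /= !mxE.
have Eg j : entry (gamma r) j =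
   (cosh r * (j == o 3)%:R +i* (sinh r * (j == o 2)%:R))%C.
  by rewrite /entry /gamma /= !mxE -!val_eqE /= !eqSS.
rewrite !E !Eg /=; apply/eqP; rewrite eq_complex /=.
by apply/andP; split; apply/eqP; ring.
Qed.

Variables (U W : set VV) (phi : VV -> C4 R) (P : VV -> 'M[R]_4) (s : VV -> R).
Hypothesis oW : open W.
Hypothesis WU : W `<=` U.
Hypothesis sphi : smooth_on U phi.
Hypothesis PP : forall u, W u -> (P u)^T *m P u = 1%:M.
Hypothesis CP : forall m a b, Ck W m (fun u => P u a b).
Hypothesis Cs : forall m, Ck W m s.
Hypothesis phiE : forall u, W u -> phi u = act (P u) (gamma (s u)).

Let P_mc i u : W u -> P u *m mcform P i u = dmx i P u.
Proof.
move=> Wu; have PPt : P u *m (P u)^T = 1%:M by apply: mulmx1C; apply: PP.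
by rewrite /mcform mulmxA PPt mul1mx.
Qed.

(** d(P . gamma s) = P . (gamma' ds + (P^-1 dP) gamma), and the part of P^-1 dP
along E_12 kills gamma. *)
Lemma partial_lift i u : W u ->
  partial i phi u = act (P u) (framevec (s u) (\row_k coframe_entry P s i u k)).
Proof.
move=> Wu; apply: C4_eq => b j.
have [_ <-] := pd_component b j i (sphi [::] (WU Wu)).
rewrite component_act sum4 !component_framevec.
have dP a : differentiable (fun x => P x j a) u := Ck_differentiable (CP 1 j a) Wu.
have ds : differentiable s u := Ck_differentiable (Cs 1) Wu.
have dPE a : pd i (fun x => P x j a) u = \sum_k P u j k * mcform P i u k a.
  have /(congr1 (fun A : 'M[R]_4 => A j a)) := P_mc i Wu.
  by rewrite [LHS]mxE [RHS]mxE => <-.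
have sk a c : mcform P i u a c = - mcform P i u c a.
  have /(congr1 (fun A : 'M[R]_4 => A c a)) := mcform_skew oW PP CP i Wu.
  by rewrite [LHS]mxE [RHS]mxE.
have dg a : mcform P i u a a = 0 by have := sk a a; lra.
have key (f f' : R -> R) a : is_derive (s u) (1 : R) f (f' (s u)) ->
  (forall x, W x -> component b j (phi x) = f (s x) * P x j a) ->
  pd i (fun x => component b j (phi x)) u =
   f' (s u) * pd i s u * P u j a + f (s u) * \sum_k P u j k * mcform P i u k a.
  move=> df fE.
  rewrite (@pd_near _ _ _ _ (fun x => f (s x) * P x j a)); last first.
    by near=> x; apply: fE; near: x; exact: open_nbhs_nbhs.
  have dfs : differentiable (fun x => f (s x)) u by apply: differentiable_comp1.
  rewrite (pdM _ dfs (dP a)) pd_comp// derive1E derive_val dPE //.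
case: b key => key.
  rewrite (key (@sinh R) (@cosh R) (o 2) (is_derive_sinh _)); last first.
    by move=> x Wx; rewrite phiE// /component /act /gamma /= (mul_e _ _ (o 2)).
  rewrite sum4 dg (sk (o 3) (o 2)) /framevec2 /=; ring.
rewrite (key (@cosh R) (@sinh R) (o 3) (is_derive_cosh _)); last first.
  by move=> x Wx; rewrite phiE// /component /act /gamma /= (mul_e _ _ (o 3)).
rewrite sum4 dg /framevec1 /=; ring.
Unshelve. all: by end_near.
Qed.

(** By partial_lift, a linear relation between the columns of the coframe is one
between the partial derivatives of the parametrization. *)
Lemma coframe_unit u : W u ->
  (forall a : VV, \sum_i a 0 i *: partial i phi u = 0 -> a = 0) ->
  coframe P s u \in unitmx.
Proof.
move=> Wu indep; rewrite -unitmx_tr -row_free_unit -kermx_eq0.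
apply/rowV0P => a /sub_kermxP aF; apply: indep.
transitivity (act (P u) (framevec (s u) (a *m (coframe P s u)^T))); last first.
  rewrite aF /framevec big1 ?/act /=; last by move=> k _; rewrite mxE scale0r.
  by rewrite !mulmx0.
apply: C4_eq => b j; rewrite component_act.
have sumE n (F : 'I_n -> C4 R) k : component b k (\sum_i F i) = \sum_i component b k (F i).
  exact: (raddf_sum (component b k : {linear C4 R -> R^o})).
have scE k x z : component b k (x *: z) = x * component b k z.
  by rewrite /component; case: (b); rewrite /= mxE.
rewrite sumE; under eq_bigr => i _ do rewrite scE partial_lift// component_act big_distrr/=.
rewrite exchange_big/=; apply: eq_bigr => k _.
under eq_bigr do rewrite mulrCA; rewrite -big_distrr/=; congr (_ * _).
rewrite /framevec sumE.
under eq_bigr => i _ do rewrite sumE big_distrr/=.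
rewrite exchange_big/=; apply: eq_bigr => l _; rewrite scE mxE big_distrl/=.
by apply: eq_bigr => i _; rewrite scE !mxE mulrA.
Qed.

Lemma g_along_metric_mx c v t (F : 'M[R]_6) i j :
  g_along c v t (\row_k F k i) (\row_k F k j) =
  (F^T *m metric_mx (derive1 v t) (v t * tanh t) (v t / tanh t) (w c t) *m F) i j.
Proof.
have cE k l : (k < 6)%N -> coform k (\row_m F m l) = F (inord k) l.
  by move=> k6; rewrite /coform mxE.
pose f l (k : nat) := F (inord k) l.
have fE l (k : 'I_6) : F k l = f l k by rewrite /f inord_val.
transitivity (\sum_(0 <= a < 6) (\sum_(0 <= b < 6) f i b *
   metric_tab (derive1 v t) (v t * tanh t) (v t / tanh t) (w c t) b a) * f j a); last first.
  rewrite big_mkord mxE; apply: eq_bigr => a _; rewrite fE mxE big_mkord; congr (_ * _).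
  by apply: eq_bigr => b _; rewrite !mxE fE.
rewrite /g_along /tsquare /odot !cE// !sum6; cbn [metric_tab].
rewrite -!/(f _ _); move: (f i) (f j) => fi fj; ring.
Qed.

(** By invariance under P u, the Gram matrix of the partial derivatives can be
computed at gamma (s u). *)
Lemma pullback_lift rho c v g u : is_gc c rho v g -> W u ->
  0 < s u -> ((s u)%:E < rho)%E -> SO4 (P u) ->
  let t := s u in
  pullback g phi u = (coframe P s u)^T *m
     metric_mx (derive1 v t) (v t * tanh t) (v t / tanh t) (w c t) *m coframe P s u.
Proof.
move=> [inv gE] Wu s0 srho SP t; apply/matrixP => i j.
rewrite -g_along_metric_mx mxE.
have rowE k : \row_l coframe P s u l k = \row_l coframe_entry P s k u l.
  by apply/rowP => l; rewrite !mxE.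
rewrite !rowE -gE// phiE// !partial_lift//.
have S1 : SO4 (1%:M : 'M[R]_4) by split; rewrite ?trmx1 ?mulmx1 ?det1.
have Mg : tube rho (gamma t).
  by exists 1%:M, t; split=> //; rewrite /act !mul1mx -surjective_pairing.
have [_ _ _ iso] := inv _ _ _ Mg (tangent_framevec t (coframe_entry P s i u))
   (tangent_framevec t (coframe_entry P s j u)).
exact: iso.
Qed.

End Pullback.

(** * The profile functions and the scalar curvature *)

Section Profile.
Variable R : realType.
Implicit Types t : R.

Definition dcoth2 t : R := - 2 / sinh (2 * t) ^+ 2.

Lemma cosh2_sinh2 t : cosh t ^+ 2 = 1 + sinh t ^+ 2.
Proof.
rewrite /cosh /sinh expRN; have := expR_gt0 t; move: (expR t) => x x0.
by field; rewrite gt_eqF.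
Qed.

Lemma sinh_double t : sinh (2 * t) = 2 * sinh t * cosh t.
Proof.
have -> : 2 * t = t + t by ring.
rewrite /sinh /cosh !expRN !expRD.
by have := expR_gt0 t; move: (expR t) => x x0; field; rewrite gt_eqF.
Qed.

Lemma cosh_double t : cosh (2 * t) = 1 + 2 * sinh t ^+ 2.
Proof.
have -> : 2 * t = t + t by ring.
rewrite /sinh /cosh !expRN !expRD.
by have := expR_gt0 t; move: (expR t) => x x0; field; rewrite gt_eqF.
Qed.

Lemma is_derive_tanh t : is_derive t (1 : R) (@tanh R) (1 - tanh t ^+ 2).
Proof.
have c0 : cosh t != 0 by rewrite gt_eqF// cosh_gt0.
apply: (der_eq (derM (is_derive_sinh t) (derV (is_derive_cosh t) c0))).
by rewrite /tanh; field.
Qed.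

Lemma is_derive_coth2 t : 0 < t ->
  is_derive t (1 : R) (fun x => coth (2 * x)) (dcoth2 t).
Proof.
move=> t0; have s0 : sinh (2 * t) != 0 by rewrite gt_eqF// sinh_gt0// mulr_gt0.
have d2 : is_derive t (1 : R) (fun x : R => 2 * x) 2.
  by apply: (der_eq (derM (der_cst 2 t) (is_derive_id t 1))); rewrite mul0r add0r mulr1.
have dc : is_derive t (1 : R) (fun x : R => cosh (2 * x)) (2 * sinh (2 * t)).
  apply: (der_eq (@is_derive1_comp R (@cosh R) _ t _ _ (is_derive_cosh (2 * t)) d2)).
  by rewrite mulrC.
have ds : is_derive t (1 : R) (fun x : R => sinh (2 * x)) (2 * cosh (2 * t)).
  apply: (der_eq (@is_derive1_comp R (@sinh R) _ t _ _ (is_derive_sinh (2 * t)) d2)).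
  by rewrite mulrC.
apply: (der_eq (derM dc (derV ds s0))); rewrite /dcoth2.
have := cosh2_sinh2 (2 * t); move: (cosh (2 * t)) (sinh (2 * t)) s0 => C S S0 CS.
transitivity ((2 * S ^+ 2 - 2 * C ^+ 2) / S ^+ 2); first by field.
by rewrite CS; field.
Qed.

Variable c : R.

(** The first and second derivatives of w_c.  The latter is proportional to w_c
itself; this is how w_c'' is eliminated from the curvature. *)
Definition w_deriv t : R := c * (coth (2 * t) - 2 * t / sinh (2 * t) ^+ 2).
Definition w_deriv2 t : R := 8 * w c t / sinh (2 * t) ^+ 2.

Lemma is_derive_w t : 0 < t -> is_derive t (1 : R) (w c) (w_deriv t).
Proof.
move=> t0; have dco := is_derive_coth2 t0.
apply: (der_eq (derM (der_cst c t)
  (derB (derM (is_derive_id t 1) dco) (der_cst 2^-1 t)))).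
by rewrite /w_deriv /dcoth2; ring.
Qed.

Lemma is_derive_w_deriv t : 0 < t -> is_derive t (1 : R) w_deriv (w_deriv2 t).
Proof.
move=> t0; have dco := is_derive_coth2 t0.
have s0 : sinh (2 * t) != 0 by rewrite gt_eqF// sinh_gt0// mulr_gt0.
have d2 : is_derive t (1 : R) (fun x : R => 2 * x) 2.
  by apply: (der_eq (derM (der_cst 2 t) (is_derive_id t 1))); rewrite mul0r add0r mulr1.
have ds : is_derive t (1 : R) (fun x : R => sinh (2 * x)) (2 * cosh (2 * t)).
  apply: (der_eq (@is_derive1_comp R (@sinh R) _ t _ _ (is_derive_sinh (2 * t)) d2)).
  by rewrite mulrC.
have ss0 : sinh (2 * t) * sinh (2 * t) != 0 by rewrite mulf_neq0.
apply: (der_eq (derM (der_cst c t)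
  (derB dco (derM d2 (derV (derM ds ds) ss0))))).
by rewrite /w_deriv2 /w /dcoth2 /coth; field.
Qed.

End Profile.

(** The closed formula for p = v T, q = v / T with T = tanh r.  Here V1 is the
value of v'' given by the differential equation and V2 its derivative; S and co
stand for sinh (2 r) and coth (2 r). *)
Lemma scal_profile (R : realType) (v V w w1 T S co : R) :
  let k := 1 - T ^+ 2 in
  let dco := - 2 / S ^+ 2 in
  let w2 := 8 * w / S ^+ 2 in
  let E := v ^+ 2 - w ^+ 2 in
  let E1 := 2 * v * V - 2 * w * w1 in
  let N := v * V + w * w1 in
  let V1 := 4 * V * co - 2 * V * (N / E) in
  let N1 := V ^+ 2 + v * V1 + w1 ^+ 2 + w * w2 in
  let V2 := 4 * (V1 * co + V * dco)
    - 2 * (V1 * (N / E) + V * (N1 / E - N * E1 / E ^+ 2)) in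
  let p := v * T in
  let p1 := V * T + v * k in
  let p2 := V1 * T + 2 * V * k - 2 * v * T * k in
  let q := v / T in
  let q1 := V / T - v * k / T ^+ 2 in
  let q2 := V1 / T - 2 * V * k / T ^+ 2 + 2 * v * k / T ^+ 3 in
  S = 2 * T / k -> co = (1 + T ^+ 2) / (2 * T) ->
  T != 0 -> k != 0 -> V != 0 -> E != 0 ->
  \sum_(0 <= d < 6) \sum_(0 <= b < 6) metric_inv_tab V p q w d b *
    ricci_tab (levi_civita_coefs V p q w V1 p1 q1 w1)
        (levi_civita_dcoefs V p q w V1 p1 q1 w1 V2 p2 q2 w2) d b =
  (5 * v ^+ 2 + w ^+ 2) * w1 ^+ 2 / (V * E ^+ 2) + 40 * w ^+ 2 / (V * E * S ^+ 2).
Proof.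
move=> k dco w2 E E1 N V1 N1 V2 p p1 p2 q q1 q2 SE coE T0 k0 V0 E0.
have DE : p * q - w ^+ 2 = E by rewrite /p /q /E; field.
rewrite scal_tab ?DE//.
have D1E : p1 * q + p * q1 - 2 * w * w1 = E1.
  by rewrite /p1 /q1 /p /q /E1 /k; field.
rewrite D1E.
have D2E : p2 * q + 2 * p1 * q1 + p * q2 - 2 * w1 ^+ 2 - 2 * w * w2 =
   2 * (V ^+ 2 + v * V1) - 2 * w1 ^+ 2 - 2 * w * w2.
  by rewrite /p2 /p1 /q1 /q2 /p /q /k; field.
rewrite D2E {D1E D2E DE}.
rewrite /V2 /N1.
set x := N / E.
have V1E : V1 = V * (4 * co - 2 * x) by rewrite /V1 /x; ring.
rewrite V1E {V1E} /q1 /p1 /p /q /w2 /dco /E1 /N1.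
rewrite /x /N coE SE; rewrite /E in E0 *; rewrite /k in k0 *.
by field; rewrite V0 T0 E0 k0.
Qed.

Lemma framevec_xi_neq0 (R : realType) (r : R) : 0 < r ->
  framevec r (\row_k (k == ord0)%:R) != 0.
Proof.
move=> r0.
pose a (k : nat) : R := (k == 0%N)%:R.
have -> : (\row_k (k == ord0)%:R : 'rV[R]_6) = \row_k a k by apply/rowP => k; rewrite !mxE.
apply/eqP => /(congr1 (component false (Ordinal (isT : 3 < 4)%N))).
rewrite component_framevec /= mulr1 /component /= mxE => /eqP.
by rewrite gt_eqF// sinh_gt0.
Qed.

Theorem proposition5p1 (R : realType) (c : R) (rho : \bar R) (v : R -> R)
    (g : C4 R -> C4 R -> C4 R -> R) (r : R) :
  is_solution c rho v ->
  is_gc c rho v g ->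
  0 < r -> (r%:E < rho)%E ->
  positive_definite_at g (gamma r) ->
  scalar_curvature_is (tube rho) g (gamma r)
    ((5 * v r ^+ 2 + w c r ^+ 2) * derive1 (w c) r ^+ 2
       / (derive1 v r * Delta c v r ^+ 2)
     + 40 * w c r ^+ 2 / (derive1 v r * Delta c v r * sinh (2 * r) ^+ 2)).
Proof.
move=> [_ _ _ sol] gc r0 rrho posg U phi u0 pphi Uu0 phi0.
pose V t := derive1 v t.
pose E t := v t ^+ 2 - w c t ^+ 2.
pose N t := v t * V t + w c t * w_deriv c t.
pose co t : R := coth (2 * t).
pose V1 t := 4 * V t * co t - 2 * V t * (N t / E t).
pose k t : R := 1 - tanh t ^+ 2.
pose p t := v t * tanh t.
pose p1 t := V t * tanh t + v t * k t.
pose p2 t := V1 t * tanh t + 2 * V t * k t - 2 * v t * tanh t * k t.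
pose q t := v t / tanh t.
pose q1 t := V t / tanh t - v t * k t / tanh t ^+ 2.
pose q2 t := V1 t / tanh t - 2 * V t * k t / tanh t ^+ 2 + 2 * v t * k t / tanh t ^+ 3.
pose E1 t := 2 * v t * V t - 2 * w c t * w_deriv c t.
pose N1 t := V t ^+ 2 + v t * V1 t + w_deriv c t ^+ 2 + w c t * w_deriv2 c t.
pose V2 t := 4 * (V1 t * co t + V t * dcoth2 t)
    - 2 * (V1 t * (N t / E t) + V t * (N1 t / E t - N t * E1 t / E t ^+ 2)).
have tanh0 (t : R) : 0 < t -> tanh t != 0.
  by move=> t0; rewrite gt_eqF// divr_gt0// ?sinh_gt0// cosh_gt0.
have profile (t : R) : 0 < t -> (t%:E < rho)%E -> [/\ E t != 0,
   is_derive t (1 : R) v (V t) & is_derive t (1 : R) V (V1 t)].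
  move=> t0 trho; have [dv dV E0 ode] := sol t t0 trho.
  have dw := is_derive_w c t0.
  have wE : derive1 (w c) t = w_deriv c t by rewrite derive1E; exact: derive_val.
  have VE : derive1 V t = V1 t.
    move: ode; rewrite wE -/(V t) -/(E t) -/(co t) -/(N t) => ode.
    by apply/eqP; rewrite -subr_eq0 -[X in _ == X]ode /V1; apply/eqP; ring.
  split; first exact: E0.
    exact: (DeriveDef dv (esym (derive1E v t))).
  exact: (DeriveDef dV (etrans (esym (derive1E V t)) VE)).
have reg (t : R) : 0 < t -> (t%:E < rho)%E -> V t != 0 ->
  [/\ V t != 0, p t * q t - w c t ^+ 2 != 0,
   [/\ is_derive t (1 : R) V (V1 t), is_derive t (1 : R) p (p1 t),
       is_derive t (1 : R) q (q1 t) & is_derive t (1 : R) (w c) (w_deriv c t)] &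
   [/\ is_derive t (1 : R) V1 (V2 t), is_derive t (1 : R) p1 (p2 t),
       is_derive t (1 : R) q1 (q2 t) & is_derive t (1 : R) (w_deriv c) (w_deriv2 c t)]].
  move=> t0 trho Vt0; have [E0 dv dV] := profile t t0 trho.
  have T0 := tanh0 t t0.
  have dw := is_derive_w c t0; have dw1 := is_derive_w_deriv c t0.
  have dT := is_derive_tanh t; have dco := is_derive_coth2 t0.
  have dE : is_derive t (1 : R) E (E1 t).
    by apply: (der_eq (derB (derM dv dv) (derM dw dw))); rewrite /E1; ring.
  have dN : is_derive t (1 : R) N (N1 t).
    by apply: (der_eq (derD (derM dv dV) (derM dw dw1))); rewrite /N1; ring.
  have dTi := derV dT T0.
  have dk : is_derive t (1 : R) k (- 2 * tanh t * k t).
    by apply: (der_eq (derB (der_cst 1 t) (derM dT dT))); rewrite /k; ring.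
  have TT0 : tanh t * tanh t != 0 by rewrite mulf_neq0.
  have pqE : p t * q t - w c t ^+ 2 != 0.
    by have -> : p t * q t - w c t ^+ 2 = E t by rewrite /p /q /E; field.
  have dp : is_derive t (1 : R) p (p1 t) by exact: (derM dv dT).
  have dq : is_derive t (1 : R) q (q1 t).
    by apply: (der_eq (derM dv dTi)); rewrite /q1 /k; field.
  have dV1 : is_derive t (1 : R) V1 (V2 t).
    apply: (der_eq (derB (derM (derM (der_cst 4 t) dV) dco)
      (derM (derM (der_cst 2 t) dV) (derM dN (derV dE E0))))).
    by rewrite /V2 -/(co t); field.
  have dp1 : is_derive t (1 : R) p1 (p2 t).
    by apply: (der_eq (derD (derM dV dT) (derM dv dk))); rewrite /p2 /k; ring.
  have dq1 : is_derive t (1 : R) q1 (q2 t).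
    apply: (der_eq (derB (derM dV dTi) (derM (derM dv dk) (derV (derM dT dT) TT0)))).
    by rewrite /q2 /k; field.
  exact: (And4 Vt0 pqE (And4 dV dp dq dw) (And4 dV1 dp1 dq1 dw1)).
(* The metric takes the value v' on (xi, xi). *)
have Vr0 : 0 < V r.
  have tang := tangent_framevec r (fun k => (k == 0%N)%:R).
  have rowE : (\row_k (k == ord0)%:R : 'rV[R]_6) = \row_k ((k : nat) == 0%N)%:R.
    by apply/rowP => j; rewrite !mxE.
  have := framevec_xi_neq0 r0; rewrite rowE => /(posg _ tang).
  have [_ -> //] := gc.
  rewrite /g_along /tsquare /odot /coform !mxE !inordK//=.
  by rewrite !(mulr0, mulr1, addr0, subr0).
have [W0 [P [s [[oW0 Wu0 W0U su0] CP Cs liftE]]]] := local_lift pphi Uu0 r0 phi0.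
(* Near u0 the metric stays nondegenerate, as V is continuous. *)
pose W := W0 `&` [set u | 0 < V (s u)].
have WW0 : W `<=` W0 by move=> u [].
have oW : open W.
  rewrite openE => u [Wu Vu]; apply: filterI; first exact: open_nbhs_nbhs.
  have [_ s0 srho _] := liftE u Wu; have [_ _ dV] := profile _ s0 srho.
  have ds := Ck_differentiable (Cs 1) Wu.
  have /differentiable_continuous cV : differentiable (fun x => V (s x)) u.
    by apply: differentiable_comp1.
  exact: (cvgr_gt _ cV).
have [_ _ sphi indep] := pphi.
have WU : W `<=` U by move=> u /WW0 /W0U.
have CPW n a b := Ck_subset WW0 (CP n a b).
have CsW n := Ck_subset WW0 (Cs n).
have PP u : W u -> (P u)^T *m P u = 1%:M by move=> /WW0 /liftE[[]].
have phiE u : W u -> phi u = act (P u) (gamma (s u)) by move=> /WW0 /liftE[].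
have Wu0' : W u0 by split=> //=; rewrite su0.
have uF u : W u -> coframe P s u \in unitmx.
  move=> Wu; apply: (coframe_unit oW WU sphi PP CPW CsW phiE Wu).
  by move=> a; apply: indep; apply: WU.
have GE u : W u -> let t := s u in pullback g phi u =
    (coframe P s u)^T *m metric_mx (V t) (p t) (q t) (w c t) *m coframe P s u.
  move=> Wu t; have [? ? ? ?] := liftE u (WW0 _ Wu).
  exact: (pullback_lift oW WU sphi PP CPW CsW phiE gc).
have regW u (Wu : W u) := let: And4 _ s0 srho _ := liftE u (WW0 _ Wu) in
  reg (s u) s0 srho (lt0r_neq0 Wu.2).
apply: etrans (scal_lift oW PP CPW CsW uF GE regW Wu0') _.
rewrite su0.
have T0 := tanh0 r r0.
have c0 : cosh r != 0 by rewrite gt_eqF// cosh_gt0.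
have s0 : sinh r != 0 by rewrite gt_eqF// sinh_gt0.
have kE : 1 - tanh r ^+ 2 = (cosh r ^+ 2)^-1.
  have -> : 1 - tanh r ^+ 2 = (cosh r ^+ 2 - sinh r ^+ 2) / cosh r ^+ 2.
    by rewrite /tanh; field.
  by rewrite cosh2_sinh2 addrK mul1r.
have k0 : 1 - tanh r ^+ 2 != 0 by rewrite kE invr_eq0 expf_neq0.
have SE : sinh (2 * r) = 2 * tanh r / (1 - tanh r ^+ 2).
  by rewrite kE sinh_double /tanh; field.
have coE : coth (2 * r) = (1 + tanh r ^+ 2) / (2 * tanh r).
  rewrite /coth sinh_double cosh_double.
  have -> : 1 + 2 * sinh r ^+ 2 = cosh r ^+ 2 + sinh r ^+ 2.
    by rewrite cosh2_sinh2; ring.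
  by rewrite /tanh; field; rewrite c0 s0.
have [E0 _ _] := profile r r0 rrho.
have wE : derive1 (w c) r = w_deriv c r.
  by rewrite derive1E; have dw := is_derive_w c r0; exact: derive_val.
rewrite wE.
refine (@scal_profile R (v r) (V r) (w c r) (w_deriv c r) (tanh r) _ _
  SE coE T0 k0 (lt0r_neq0 Vr0) E0).
Qed.
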